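(* Let $\mathcal{G}$ be an ultragraph that satisfies Condition (RFUM2). For each $\alpha\in\mathcal{L}^*$ let $\phi_\alpha:\widehat{\mathcal{B}_\alpha}\to\{\{v\}\mid v\in r(\alpha)\}\cup\{B\in A_s\cup A_\infty\mid B\subseteq r(\alpha)\}$ be the bijective correspondence described in the context. Then the map $\Phi:\mathsf{T}\to X$ which sends a tight filter $\xi$ with associated word $\alpha$ to $$\Phi(\xi)=\begin{cases}(\phi_\omega(\xi_0),\phi_\omega(\xi_0)), & \text{if }\alpha=\omega,\\ (\alpha,\phi_\alpha(\xi_{|\alpha|})), & \text{if }0<|\alpha|<\infty,\\ \alpha, & \text{if }|\alpha|=\infty,\end{cases}$$ is a homeomorphism.
   Context: Ultragraph. An ultragraph is a quadruple $\mathcal{G}=(G^0,\mathcal{G}^1,r,s)$ with $G^0,\mathcal{G}^1$ countable sets, $s:\mathcal{G}^1\to G^0$, $r:\mathcal{G}^1\to P(G^0)\setminus\{\emptyset\}$ ($P$ = power set). $\mathcal{G}^0\subseteq P(G^0)$ is the smallest family containing $\emptyset$, all $\{v\}$ ($v\in G^0$), all $r(e)$ ($e\in\mathcal{G}^1$), and closed under finite unions and finite intersections (closure under relative complements is NOT required). $\mathcal{B}$ is the smallest family containing $\mathcal{G}^0$ and closed under relative complements, finite unions and finite intersections. Paths. $\mathcal{L}^*$ is the set consisting of the empty word $\omega$ ($|\omega|=0$) and all words $e_1\cdots e_n$ ($n\ge1$) of edges with $s(e_{i+1})\in r(e_i)$; $\mathfrak{p}^\infty$ is the set of infinite paths $e_1e_2\cdots$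 with $s(e_{i+1})\in r(e_i)$. For $\alpha=e_1\cdots e_n$, $s(\alpha)=s(e_1)$, $r(\alpha)=r(e_n)$; $r(\omega)=G^0$. $\alpha_{1,n}$ is the beginning of $\alpha$ of length $n$. $\mathcal{B}_\alpha=\{A\in\mathcal{B}: A\subseteq r(\alpha)\}$, a Boolean algebra (relatively complemented distributive lattice with least element, a greatest element not being required). For $A\in\mathcal{B}$: $r(A,\omega)=A$; for $|\alpha|\ge1$, $r(A,\alpha)=r(\alpha)$ if $s(\alpha)\in A$ and $\emptyset$ otherwise. $\varepsilon(A)=\{e\in\mathcal{G}^1: s(e)\in A\}$; $G^0_s$ is the set of sinks (vertices $v$ with $s^{-1}(v)=\emptyset$). Filters. A filter in a poset with least element $0$ is a nonempty up-closed, down-directed subset not containing $0$; an ultrafilter is a maximal filter. $\widehat{\mathcal{B}_\alpha}$ is the set of ultrafilters in $\mathcal{B}_\alpha$. Tight spectrum. $E(S)=\{(\alpha,A,\alpha):\alpha\in\mathcal{L}^*,\ \emptyset\ne A\in\mathcal{B}_\alpha\}\cup\{0\}$ is a meet semilattice with product $(\alpha,A,\alpha)(\beta,B,\beta)=(\beta,r(A,\gamma)\cap B,\beta)$ if $\beta=\alpha\gamma$ and $r(A,\gamma)\cap B\neq\emptyset$, symmetrically if $\alpha=\beta\gamma$, and $0$ otherwise; $p\le q$ iff $pq=p$. Filters in $E(S)$ carry the topology of pointwise convergence of their characteristic functions $E(S)\to\{0,1\}$; the set $\mathsf{T}$ of tight filters is the closure, in the space of all filters, of the set of ultrafilters in $E(S)$,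 with the subspace topology; a basis is given by the sets $\{\xi\in\mathsf{T}: e\in\xi,\ e_1,\dots,e_n\notin\xi\}$, $e,e_i\in E(S)$, $n\ge 0$. Each filter $\xi$ in $E(S)$ has an associated word $\alpha\in\mathcal{L}^*\cup\mathfrak{p}^\infty$: the words occurring in nonzero elements of $\xi$ are exactly the finite beginnings of $\alpha$. For finite $n$ with $0\le n\le|\alpha|$, $\xi_n=\{A\in\mathcal{B}:(\alpha_{1,n},A,\alpha_{1,n})\in\xi\}$; if $\xi$ is tight then each $\xi_n$ is an ultrafilter in $\mathcal{B}_{\alpha_{1,n}}$. Minimal sets. $A\in\mathcal{G}^0$ is a minimal infinite emitter if $|\varepsilon(A)|=\infty$ and $A$ has no proper subset in $\mathcal{G}^0$ that is an infinite emitter (i.e. $|\varepsilon(\cdot)|=\infty$) and no proper subset in $\mathcal{G}^0$ that is a finite emitter of infinite cardinality; $A_\infty$ is the set of these. $A\in\mathcal{G}^0$ is a minimal sink if $|A|=\infty$, $|\varepsilon(A)|<\infty$ and $A$ has no proper subset in $\mathcal{G}^0$ of infinite cardinality; $A_s$ is the set of these. Condition (RFUM2): for each $e\in\mathcal{G}^1$, $r(e)$ is a finite union $\bigcup_{n=1}^kA_n$ where each $A_n$ is a minimal infinite emitter, or a minimal sink, or a singleton consisting of a sink or of a regular vertex (one with $0<|s^{-1}(v)|<\infty$). Correspondence $\phi_\alpha$. Under (RFUM2), every ultrafilter in $\mathcal{B}_\alpha$ is either $\{C\in\mathcal{B}_\alpha: v\in C\}$ for a unique $v\in r(\alpha)$,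 and then $\phi_\alpha$ sends it to $\{v\}$; or it is $\{C\in\mathcal{B}_\alpha:\exists A\in\mathcal{B}_\alpha,\ |A|<\infty,\ C\supseteq B\setminus A\}$ for a unique $B\in A_s\cup A_\infty$ with $|B|=\infty$, $B\subseteq r(\alpha)$, and then $\phi_\alpha$ sends it to $B$. This gives a bijection (finite members of $A_\infty$ are singletons). Boundary path space. Ultrapaths: $\mathfrak{p}$ is the set of pairs $(\alpha,A)$ with $\alpha$ a path of length $|\alpha|\ge1$, $A\in\mathcal{G}^0$, $A\subseteq r(\alpha)$, together with the pairs $(A,A)$, $A\in\mathcal{G}^0$ (length $0$). Let $\mathcal{G}^0_s=\{\{v\}:v\in G^0_s\}$. Put $X_{min}=\{(\alpha,A)\in\mathfrak{p}:|\alpha|\ge1,A\in A_\infty\}\cup\{(A,A):A\in A_\infty\}$, $X_{sin}=\{(\alpha,A)\in\mathfrak{p}:|\alpha|\ge1,A\in\mathcal{G}^0_s\cup A_s\}\cup\{(A,A):A\in\mathcal{G}^0_s\cup A_s\}$, $X_{fin}=X_{min}\sqcup X_{sin}$ and $X=\mathfrak{p}^\infty\sqcup X_{fin}$. Topology on $X$: for $(\beta,B)\in\mathfrak{p}$ with $|\beta|\ge1$, $D_{(\beta,B)}=\{y\in X:y=\beta\gamma,\ s(\gamma)\in B\}$, i.e. all infinite paths $\beta\gamma$ with $s(\gamma)\in B$, all $(\beta\gamma',C)\in X_{fin}$ with $|\gamma'|\ge1$, $s(\gamma')\in B$, and all $(\beta,C)\in X_{fin}$ with $C\subseteq B$. For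 $(\beta,B)\in X_{fin}$ and finite $F\subseteq\varepsilon(B)$, $S\subseteq B\cap G^0_s$, $$D_{(\beta,B),F,S}=\{(\beta,B)\}\cup\{y\in X:y=\beta\gamma',\ |\gamma'|\ge1,\ \gamma'_1\in\varepsilon(B)\setminus F\}\cup\{y\in X_{sin}:y=(\beta,\{v\}),\ v\in B\setminus S\},$$ where when $|\beta|=0$ (so $(\beta,B)=(B,B)$) $\beta\gamma'$ means $\gamma'$ and $(\beta,\{v\})$ means $(\{v\},\{v\})$; here $\gamma'$ is an infinite path or an ultrapath of length at least $1$. All these sets form a basis for the topology on $X$. *)

(* Defs.v *)
From HB Require Import structures.
From mathcomp Require Import all_boot all_classical.
From mathcomp Require Import topology measurable_structure.

Set Implicit Arguments.
Unset Strict Implicit.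
Unset Printing Implicit Defensive.

Local Open Scope classical_set_scope.

Definition homeomorphism (X Y : topologicalType) (f : X -> Y) : Prop :=
  exists g : Y -> X,
    [/\ cancel f g, cancel g f, continuous f & continuous g].

(* Filters and ultrafilters in a subset P of a type T, where P is ordered by le
   with least element zero. *)
Definition poset_filter (T : Type) (P : set T) (le : T -> T -> Prop) (zero : T)
    (F : set T) : Prop :=
  [/\ F `<=` P, F !=set0,
      forall x y, F x -> P y -> le x y -> F y,
      forall x y, F x -> F y -> exists z, [/\ F z, le z x & le z y]
    & ~ F zero].

Definition poset_ultrafilter (T : Type) (P : set T) (le : T -> T -> Prop)
    (zero : T) (F : set T) : Prop :=
  poset_filter P le zero F /\
  forall F', poset_filter P le zero F' -> F `<=` F' -> F' = F.

Record ultragraph := Ultragraph {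
  vertex : Type;
  edge : Type;
  vertex_countable : countable [set: vertex];
  edge_countable : countable [set: edge];
  src : edge -> vertex;
  rng : edge -> set vertex;
  rng_neq0 : forall e, rng e !=set0 }.

Section Ultragraph.
Context (G : ultragraph).
Local Notation V := (vertex G).
Local Notation E := (edge G).

Definition gzero : set (set V) :=
  smallest [set M | setU_closed M /\ setI_closed M]
    ([set set0] `|` range set1 `|` range (@rng G)).

Definition bfam : set (set V) :=
  smallest [set M | [/\ setU_closed M, setI_closed M & setD_closed M]] gzero.

Definition lstar : set (seq E) :=
  [set a | sorted (fun e f => src f \in rng e) a].

Definition infpath : set (nat -> E) :=
  [set x | forall n, rng (x n) (src (x n.+1))].

Definition path_rng (a : seq E) : set V :=
  if a is e :: a' then rng (last e a') else setT.

Definition balg (a : seq E) : set (set V) :=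
  [set A | bfam A /\ A `<=` path_rng a].

Definition rel_rng (A : set V) (a : seq E) : set V :=
  if a is e :: _ then (if src e \in A then path_rng a else set0) else A.

Definition emit (A : set V) : set E := [set e | A (src e)].

Definition sink (v : V) : Prop := emit [set v] = set0.

Definition regular (v : V) : Prop :=
  emit [set v] !=set0 /\ finite_set (emit [set v]).

(* The semilattice E(S): None is its zero, Some (a, A) the element (a, A, a). *)
Definition es : set (option (seq E * set V)) :=
  [set p | if p is Some (a, A) then [/\ lstar a, A !=set0 & balg a A]
           else True].

Definition es_mul (p q : option (seq E * set V)) : option (seq E * set V) :=
  match p, q with
  | Some (a, A), Some (b, B) =>
    let c := drop (size a) b in
    let d := drop (size b) a in
    if `[< b = a ++ c /\ rel_rng A c `&` B !=set0 >]
    then Some (b, rel_rng A c `&` B)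
    else if `[< a = b ++ d /\ A `&` rel_rng B d !=set0 >]
    then Some (a, A `&` rel_rng B d)
    else None
  | _, _ => None
  end.

Definition es_le (p q : option (seq E * set V)) : Prop := es_mul p q = p.

Definition es_filters : set (set (option (seq E * set V))) :=
  [set xi | poset_filter es es_le None xi].

Definition es_char (xi : es_filters) : prod_topology (fun _ : es => bool) :=
  fun p => `[< set_val xi (set_val p) >].

Definition filter_space : Type := initial_topology es_char.
HB.instance Definition _ := Topological.on filter_space.

Definition filter_elts (xi : filter_space) : set (option (seq E * set V)) :=
  set_val (xi : es_filters).

(* A subset of a topological space, coerced to a type, carries the subspace
   topology. *)
Definition tight : set filter_space :=
  closure [set xi | poset_ultrafilter es es_le None (filter_elts xi)].

Inductive word := FinWord of seq E | InfWord of nat -> E.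
HB.instance Definition _ := gen_eqMixin word.
HB.instance Definition _ := gen_choiceMixin word.

Definition begins (b : seq E) (w : word) : Prop :=
  match w with
  | FinWord a => exists c, a = b ++ c
  | InfWord x => b = mkseq x (size b)
  end.

Definition assoc_word (xi : set (option (seq E * set V))) (w : word) : Prop :=
  match w with FinWord a => lstar a | InfWord x => infpath x end /\
  forall b, (exists A, xi (Some (b, A))) <-> begins b w.

Definition word_of (xi : set (option (seq E * set V))) : word :=
  xget (FinWord [::]) [set w | assoc_word xi w].

(* When a is the beginning of length n of the word of xi, this is xi_n. *)
Definition slice (xi : set (option (seq E * set V))) (a : seq E)
    : set (set V) :=
  [set A | bfam A /\ xi (Some (a, A))].

Definition min_inf_emitter : set (set V) :=
  [set A | [/\ gzero A, infinite_set (emit A),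
    forall C, gzero C -> C `<` A -> ~ infinite_set (emit C)
  & forall C, gzero C -> C `<` A ->
      ~ (finite_set (emit C) /\ infinite_set C)]].

Definition min_sink : set (set V) :=
  [set A | [/\ gzero A, infinite_set A, finite_set (emit A)
  & forall C, gzero C -> C `<` A -> ~ infinite_set C]].

Definition RFUM2 : Prop := forall e : E,
  exists (k : nat) (A : nat -> set V),
    (forall n, (n < k)%N ->
       [\/ min_inf_emitter (A n), min_sink (A n)
         | exists2 v, A n = [set v] & sink v \/ regular v]) /\
    rng e = \bigcup_(n < k) A n.

(* phi_a is defined on ultrafilters of balg a; elsewhere it takes the value
   set0, which is neither a singleton nor in min_sink or min_inf_emitter. *)
Definition phi_graph (a : seq E) (U : set (set V)) (C : set V) : Prop :=
  poset_ultrafilter (balg a) subset set0 U /\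
  ((exists v, [/\ path_rng a v, U = [set D | balg a D /\ D v] & C = [set v]])
   \/
   [/\ min_sink C \/ min_inf_emitter C, infinite_set C, C `<=` path_rng a
     & U = [set D | balg a D /\
              exists A, [/\ balg a A, finite_set A & C `\` A `<=` D]]]).

Definition phi (a : seq E) (U : set (set V)) : set V :=
  xget set0 [set C | phi_graph a U C].

(* Infinite words and pairs (a, A); the ultrapath (A, A) of length 0 is encoded
   as the pair ([::], A). *)
Inductive xpoint := InfPoint of nat -> E | FinPoint of seq E & set V.
HB.instance Definition _ := gen_eqMixin xpoint.
HB.instance Definition _ := gen_choiceMixin xpoint.

Definition ultrapath (a : seq E) (A : set V) : Prop :=
  [/\ lstar a, gzero A & A `<=` path_rng a].

Definition xmin : set xpoint :=
  [set y | if y is FinPoint a A then ultrapath a A /\ min_inf_emitter A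
           else False].

Definition xsin : set xpoint :=
  [set y | if y is FinPoint a A
           then ultrapath a A /\
                ((exists2 v, sink v & A = [set v]) \/ min_sink A)
           else False].

Definition xfin : set xpoint := xmin `|` xsin.

Definition boundary : set xpoint :=
  [set y | if y is InfPoint x then infpath x else False] `|` xfin.

Definition cat_inf (b : seq E) (x : nat -> E) : nat -> E :=
  fun n => nth (x (n - size b)) b n.

(* y = b c, where c is an infinite path or an ultrapath of length at least 1,
   whose first edge is e *)
Definition extends_by (b : seq E) (e : E) (y : xpoint) : Prop :=
  match y with
  | InfPoint x => exists2 c, c 0%N = e & x = cat_inf b c
  | FinPoint a _ => exists c, a = b ++ e :: c
  end.

(* For y = (b, C), the condition s(c) \in B on y = b c reads C `<=` B. *)
Definition cyl (b : seq E) (B : set V) : set xpoint :=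
  boundary `&`
  [set y | (exists2 e, emit B e & extends_by b e y) \/
           (exists2 C, C `<=` B & y = FinPoint b C)].

Definition cyl_fin (b : seq E) (B : set V) (F : set E) (S : set V)
    : set xpoint :=
  [set FinPoint b B]
  `|` (boundary `&` [set y | exists2 e, (emit B `\` F) e & extends_by b e y])
  `|` (xsin `&` [set y | exists2 v, (B `\` S) v & y = FinPoint b [set v]]).

Definition boundary_base : set (set xpoint) :=
  [set U | (exists b B, [/\ (0 < size b)%N, ultrapath b B & U = cyl b B]) \/
    (exists b B F S,
      [/\ xfin (FinPoint b B),
          finite_set F /\ F `<=` emit B,
          finite_set S /\ S `<=` B `&` [set v | sink v]
        & U = cyl_fin b B F S])].

(* The family is a basis of the topology it generates (under RFUM2), so it may
   be used as a subbase. *)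
Definition boundary_space : Type := boundary.
HB.instance Definition _ := Choice.on boundary_space.
HB.instance Definition _ :=
  isSubBaseTopological.Build boundary_space boundary_base
    (fun U => set_val @^-1` U).

Definition Phi (xi : set (option (seq E * set V))) : xpoint :=
  match word_of xi with
  | FinWord a => FinPoint a (phi a (slice xi a))
  | InfWord x => InfPoint x
  end.

End Ultragraph.

Arguments tight : clear implicits.
Arguments boundary : clear implicits.
Arguments boundary_space : clear implicits.
Arguments RFUM2 : clear implicits.

(* Main.v *)
Require Import Defs.
From mathcomp Require Import all_boot all_classical topology.
From mathcomp Require Import finmap measurable_structure.

(** Under Condition (RFUM2) the inverse of [Phi] can be written down. Call a
    vertex set a cell if it is a singleton, a minimal sink or an infinite
    minimal infinite emitter. On a cell [C] every set of the Boolean algebra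
    is finite or cofinite, so [C] carries one natural ultrafilter ([filt C]):
    the principal one, or that of the cofinite subsets. A boundary point [y]
    determines the filter [Phi_inv y] of all [(b, A)] such that [y] continues
    [b] by an edge with source in [A], or [y] ends at [b] with a cell whose
    ultrafilter contains [A]. Reading the word and the cell back from [Phi_inv
    y] gives [Phi (Phi_inv y) = y] ([Phi_invK]), so the theorem reduces to
    showing that the tight filters are exactly the filters [Phi_inv y] and
    that both topologies are generated by the same sets.

    A filter is tight if and only if on each finite set of elements it
    coincides with an ultrafilter ([tight_approximable]). The filter [Phi_inv
    y] is itself maximal if [y] is infinite or ends at a sink. Otherwise [y]
    ends with a cell [C] which emits infinitely many edges or contains
    infinitely many sinks; the ultrafilters which continue along one of these
    edges, or end at one of these sinks, converge to [Phi_inv y], because a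
    set of the Boolean algebra or its complement meets [C] in finitely many
    vertices only, which emit finitely many edges if [C] is infinite
    ([Phi_inv_approximable]).

    Conversely, membership in a filter is decided along its word by the next
    edge ([filter_edge]), so a filter is determined by its word and by the
    sets at the end of that word. For a tight filter with a finite word these
    sets form a prime filter ([approximable_prime]); Condition (RFUM2) covers
    them by finitely many cells, so one cell occurs and the sets are those of
    the ultrafilter of a cell ([slice_filt]). This cell is not a regular
    vertex, since an approximating ultrafilter would have to continue along
    one of its finitely many edges ([approximable_not_regular]). Thus the
    filter is [Phi_inv y] for a boundary point [y] ([approximable_Phi_inv]).

    For the topologies, each basic set of the boundary is described near any
    of its points by finitely many conditions on membership in [Phi_inv y]
    ([base_finitely_determined]), and each such condition is constant on a
    basic set around any point ([Phi_inv_locally_constant]). *)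

Set Implicit Arguments.
Unset Strict Implicit.
Unset Printing Implicit Defensive.

Local Open Scope classical_set_scope.

(** * Sequences and filters *)

Lemma mkseqD (T : Type) (x : nat -> T) m n :
  mkseq x (m + n) = mkseq x m ++ mkseq (fun i => x (m + i)) n.
Proof. by rewrite /mkseq iotaD map_cat add0n -{2}[m]addn0 iotaDl -map_comp. Qed.

Lemma cat_eq_size (T : Type) (a b c d : seq T) :
  a ++ c = b ++ d -> size a = size b -> a = b /\ c = d.
Proof.
elim: a b => [|x a IHa] [|y b] //= [-> /IHa abcd] [/abcd[-> ->]].
by [].
Qed.

Lemma filter_finite_bigI (T I : Type) (F : set_system T) (S : set I)
    (f : I -> set T) : Filter F -> finite_set S ->
  (forall i, S i -> F (f i)) -> F (\bigcap_(i in S) f i).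
Proof.
move=> FF /(@finite_fsetP {classic I})[X SX] Ff; rewrite SX.
by apply: (@filter_bigI _ {classic I}) => i iX; apply: Ff; rewrite SX.
Qed.

(** A condition on one coordinate is a subbasic condition: convergence in a
    supremum of topologies gives convergence in each of them. *)
Lemma nbhs_coord (I : Type) (T : I -> topologicalType) (f : prod_topology T)
    i (U : set (T i)) :
  nbhs (f i) U -> nbhs f [set g : prod_topology T | U (g i)].
Proof.
move=> fU; have /cvg_sup/(_ i) H : nbhs f --> f by exact: cvg_id.
exact: H _ (@initial_continuous _ _ (fun g : (forall i, T i) => g i) f U fU).
Qed.

Section Ultragraph.
Context {G : ultragraph}.
Local Notation V := (vertex G).
Local Notation E := (edge G).

(** * Finite and infinite words *)

Definition path_word (w : word G) : Prop :=
  match w with FinWord a => lstar a | InfWord x => infpath x end.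

Lemma path_rng_rcons (b : seq E) e : path_rng (rcons b e) = rng e.
Proof. by case: b => //= f b; rewrite last_rcons. Qed.

Lemma path_rng_cat (b : seq E) e c : path_rng (b ++ e :: c) = path_rng (e :: c).
Proof. by case: b => //= f b; rewrite last_cat. Qed.

Lemma lstar_rcons (b : seq E) e :
  lstar (rcons b e) <-> lstar b /\ path_rng b (src e).
Proof.
rewrite /lstar /=; case: b => [|f b] /=; first by split.
rewrite rcons_path; split => [/andP[-> /set_mem]//|[-> h]].
by rewrite mem_set.
Qed.

Lemma lstar_prefix (b c : seq E) : lstar (b ++ c) -> lstar b.
Proof. by case: b => //= f b; rewrite /lstar /= cat_path => /andP[]. Qed.

Lemma begins_refl (a : seq E) : begins a (FinWord a).
Proof. by exists [::]; rewrite cats0. Qed.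

Lemma begins_nil w : begins ([::] : seq E) w.
Proof. by case: w => [a|x] //=; exists a. Qed.

Lemma begins_prefix (b c : seq E) w : begins (b ++ c) w -> begins b w.
Proof.
case: w => [a [d ->]|x] /=; first by exists (c ++ d); rewrite catA.
rewrite size_cat mkseqD => /cat_eq_size; rewrite size_mkseq.
by case/(_ erefl).
Qed.

Lemma begins_rcons (b : seq E) e w : begins (rcons b e) w -> begins b w.
Proof. by rewrite -cats1; exact: begins_prefix. Qed.

Lemma begins_trans (b c : seq E) w :
  begins b (FinWord c) -> begins c w -> begins b w.
Proof. by case=> d ->; exact: begins_prefix. Qed.

Lemma begins_total (b c : seq E) w : begins b w -> begins c w ->
  (size b <= size c)%N -> begins b (FinWord c).
Proof.
case: w => [a [d ad] [d' ad']|x /= -> ->] le_bc.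
  exists (drop (size b) c); move: ad.
  rewrite ad' -{1}(cat_take_drop (size b) c) -catA => /cat_eq_size.
  rewrite size_takel//.
  by case/(_ erefl) => bE _; rewrite -{1}bE cat_take_drop.
rewrite !size_mkseq in le_bc *.
exists (mkseq (fun i => x (size b + i)) (size c - size b)).
by rewrite -mkseqD subnKC.
Qed.

Lemma begins_size (b c : seq E) : begins b (FinWord c) -> (size b <= size c)%N.
Proof. by case=> d ->; rewrite size_cat leq_addr. Qed.

Lemma begins_irrefl (b : seq E) e : ~ begins (rcons b e) (FinWord b).
Proof. by move/begins_size; rewrite size_rcons ltnn. Qed.

Lemma begins_eq (b c : seq E) w : begins b w -> begins c w ->
  size b = size c -> b = c.
Proof.
move=> bw cw sbc; have [d] := begins_total bw cw (eq_leq sbc).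
case: d => [|e d] cE; first by rewrite cE cats0.
by have := leqnn (size c); rewrite {1}cE size_cat /= addnS sbc ltnNge leq_addr.
Qed.

Lemma begins_next (b : seq E) e f w :
  begins (rcons b e) w -> begins (rcons b f) w -> e = f.
Proof.
move=> be bf; have := begins_eq be bf; rewrite !size_rcons => /(_ erefl).
by case/rcons_inj.
Qed.

(** The dichotomy behind every case analysis on a point or a filter: its word
    either stops at [b] or continues with an edge. *)
Lemma begins_split (b : seq E) w : begins b w ->
  w = FinWord b \/ exists e, begins (rcons b e) w.
Proof.
case: w => [a [[|e c] ->]|x bx].
- by left; rewrite cats0.
- by right; exists e, c; rewrite cat_rcons.
- by right; exists (x (size b)); rewrite /= size_rcons mkseqS -bx.
Qed.

Lemma begins_lstar (b : seq E) w : path_word w -> begins b w -> lstar b.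
Proof.
case: w => [a la [c ab]|x px /= bE].
  by move: la; rewrite /= ab; exact: lstar_prefix.
rewrite bE; elim: (size b) {bE} => [|n IHn] //.
rewrite mkseqS; apply/lstar_rcons; split=> //.
by case: n {IHn} => // n; rewrite mkseqS path_rng_rcons; exact: px.
Qed.

Lemma begins_mkseq (x : nat -> E) n : begins (mkseq x n) (InfWord x).
Proof. by rewrite /begins size_mkseq. Qed.

Lemma begins_InfWord (b : seq E) (x : nat -> E) n :
  begins b (InfWord x) -> size b = n -> b = mkseq x n.
Proof. by move=> bx <-. Qed.

(** A word is known from its finite beginnings; this makes the associated word
    of a filter unique. *)
Lemma word_inj (v w : word G) : (forall b, begins b v <-> begins b w) -> v = w.
Proof.
have fin_inf (a : seq E) x :
    ~ forall b, begins b (FinWord a) <-> begins b (InfWord x).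
  by move=> /(_ (mkseq x (size a).+1))[_ /(_ (begins_mkseq _ _))/begins_size];
    rewrite size_mkseq ltnn.
case: v w => [a|x] [c|y] h.
- have ac : begins a (FinWord c) by apply/h; exact: begins_refl.
  have ca : begins c (FinWord a) by apply/h; exact: begins_refl.
  congr FinWord; apply: (begins_eq ac (begins_refl c)).
  by apply/eqP; rewrite eqn_leq (begins_size ac) (begins_size ca).
- by case: (fin_inf _ _ h).
- by case: (fin_inf c x) => b; rewrite h.
- congr InfWord; apply/funext => n.
  have /h/(@begins_InfWord _ _ n.+1) := begins_mkseq x n.+1.
  rewrite size_mkseq => /(_ erefl) /(congr1 (fun s => nth (x n) s n)).
  by rewrite !nth_mkseq.
Qed.

Definition point_word (y : xpoint G) : word G :=
  match y with InfPoint x => InfWord x | FinPoint a _ => FinWord a end.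

Lemma extends_byE (b : seq E) e y :
  extends_by b e y <-> begins (rcons b e) (point_word y).
Proof.
case: y => [x|a C] /=; last by split=> -[c ->]; exists c; rewrite cat_rcons.
rewrite size_rcons mkseqS; split=> [[c <- ->]|].
  rewrite /cat_inf nth_default// subnn; congr rcons.
  apply: (@eq_from_nth _ (c 0)); rewrite ?size_mkseq// => i ib.
  by rewrite nth_mkseq//; apply: set_nth_default.
case/rcons_inj => bE ->; exists (fun n => x (size b + n)); rewrite ?addn0//.
apply/funext => n; rewrite /cat_inf.
have [nb|bn] := ltnP n (size b); first by rewrite bE nth_mkseq // -bE.
by rewrite nth_default// subnKC.
Qed.

(** * The two families of vertex sets, and cells *)

Lemma gzero_sub (M : set (set V)) : setU_closed M -> setI_closed M ->
  M set0 -> (forall v, M [set v]) -> (forall e : E, M (rng e)) ->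
  @gzero G `<=` M.
Proof.
move=> MU MI M0 M1 Mr; apply: smallest_sub; first by split.
by move=> A [[->//|[v _ <-]//]|[e _ <-]].
Qed.

Lemma gzero0 : @gzero G set0.
Proof. by apply: sub_gen_smallest; left; left. Qed.

Lemma gzero1 (v : V) : @gzero G [set v].
Proof. by apply: sub_gen_smallest; left; right; exists v. Qed.

Lemma gzero_rng (e : E) : @gzero G (rng e).
Proof. by apply: sub_gen_smallest; right; exists e. Qed.

Lemma gzeroI : setI_closed (@gzero G).
Proof.
by move=> A B gA gB M MP; apply: MP.1.2; [exact: gA|exact: gB].
Qed.

Lemma gzero_bfam (A : set V) : gzero A -> bfam A.
Proof. exact: sub_gen_smallest. Qed.

Lemma bfam_sub (M : set (set V)) :
  setU_closed M -> setI_closed M -> setD_closed M -> @gzero G `<=` M ->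
  @bfam G `<=` M.
Proof. by move=> MU MI MD; apply: smallest_sub. Qed.

Lemma bfamU : setU_closed (@bfam G).
Proof.
move=> A B gA gB M MP; case: (MP) => -[MU _ _] _.
by apply: MU; [exact: gA|exact: gB].
Qed.

Lemma bfamI : setI_closed (@bfam G).
Proof.
move=> A B gA gB M MP; case: (MP) => -[_ MI _] _.
by apply: MI; [exact: gA|exact: gB].
Qed.

Lemma bfamD : setD_closed (@bfam G).
Proof.
move=> A B gA gB M MP; case: (MP) => -[_ _ MD] _.
by apply: MD; [exact: gA|exact: gB].
Qed.

Lemma bfam1 (v : V) : @bfam G [set v].
Proof. by apply: gzero_bfam; exact: gzero1. Qed.

(** The values of the correspondences phi: singletons, and the infinite
    members of A_s and A_oo. The condition on proper subsets treats minimal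
    sinks and infinite minimal infinite emitters at once, since a subset of a
    finite emitter is a finite emitter. *)
Definition cell (C : set V) : Prop :=
  gzero C /\ ((exists v, C = [set v]) \/
    infinite_set C /\ forall D, gzero D -> D `<` C ->
      finite_set D /\ finite_set (@emit G D)).

(** For a cell [C], the sets that belong to the ultrafilter attached to [C].
    When [C] is a singleton the first condition is vacuous and the second says
    that the vertex lies in the set; when [C] is infinite the first implies
    the second, and the sets are those which contain [C] up to finitely many
    vertices. *)
Definition filt (C : set V) : set (set V) :=
  [set A | finite_set (C `\` A) /\ C `&` A !=set0].

Lemma cell_neq0 C : cell C -> C !=set0.
Proof. by case=> _ [[v ->]|[/infinite_setN0 ? _]//]; exists v. Qed.

Lemma filt1 (v : V) A : filt [set v] A <-> A v.
Proof.
split=> [[_ [_ [-> //]]]|Av]; split; last by exists v.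
by apply: sub_finite_set (finite_set1 v) => u [].
Qed.

Lemma filt_infinite (C A : set V) :
  infinite_set C -> filt C A <-> finite_set (C `\` A).
Proof.
move=> Cinf; split=> [[]//|fCA]; split=> //.
by have /infinite_setN0 := infinite_setD Cinf fCA; rewrite setDD.
Qed.

Lemma filt_self C : C !=set0 -> filt C C.
Proof. by move=> C0; split; rewrite ?setDv ?setIid. Qed.

Lemma filtS (C A B : set V) : A `<=` B -> filt C A -> filt C B.
Proof.
move=> AB [fCA [v [Cv Av]]]; split; last by exists v; split => //; exact: AB.
by apply: sub_finite_set fCA; exact: setDS.
Qed.

Lemma filtI C A B : cell C -> filt C A -> filt C B -> filt C (A `&` B).
Proof.
case=> _ [[v ->] /filt1 Av /filt1 Bv|[Cinf _] [CA _] [CB _]].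
  by apply/filt1.
by apply/filt_infinite => //; rewrite setDIr finite_setU.
Qed.

Lemma filtN C A : cell C -> filt C A -> filt C (~` A) -> False.
Proof.
by move=> cC CA CnA; have [_ [v [_ []]]] := filtI cC CA CnA.
Qed.

(** For an infinite cell [C] not inside [A], the proper subset [C `&` A] lies
    in the family of generalized vertices, hence is finite, so [C `\` A] is
    infinite. *)
Lemma filt_cell C A : cell C -> gzero A -> filt C A <-> C `<=` A.
Proof.
move=> cC gA; split=> [|CA]; last exact: filtS CA (filt_self (cell_neq0 cC)).
case: cC => gC [[v ->] /filt1 Av _ -> //|[Cinf Cmin] [CA _]].
apply: contrapT => nCA; have /Cmin[|+ _] : gzero (C `&` A) by exact: gzeroI.
  by split; [exact: subIsetl|move=> CCA; apply: nCA => v /CCA[]].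
by rewrite -setDD; exact: infinite_setD.
Qed.

(** Ultrafilter property: on an infinite cell every set of the Boolean algebra
    is finite or cofinite. This holds for the generating family by minimality,
    and it is stable under the Boolean operations. *)
Lemma filt_dichotomy C A : cell C -> bfam A -> filt C A \/ filt C (~` A).
Proof.
case=> gC [[v ->] _|[Cinf Cmin] bA].
  by rewrite !filt1 /=; exact: EM.
rewrite !filt_infinite// [C `\` ~` A]setDE setCK.
move: A bA; apply: bfam_sub.
- move=> A B hA hB; rewrite setIUr finite_setU setDUr.
  case: hA => [|hA]; first by move=> ?; left; exact: finite_setIl.
  case: hB => [|hB]; first by move=> ?; left; exact: finite_setIr.
  by right.
- move=> A B hA hB; rewrite setDIr finite_setU setIA.
  case: hA => [hA|hA]; last by right; exact: finite_setIl.
  case: hB => [hB|hB]; last first.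
    by right; apply: sub_finite_set hB => v [[]].
  by left.
- move=> A B hA hB; rewrite setDDr finite_setU setIDA.
  case: hA => [hA|hA]; last by right; exact: finite_setD.
  case: hB => [hB|hB]; last by left.
  by right; apply: sub_finite_set hB => v [[]].
move=> A gA; have [CA|nCA] := EM (C `<=` A).
  by left; apply: sub_finite_set (@finite_set0 V) => v [/CA Av].
right; have /Cmin[|//] : gzero (C `&` A) by exact: gzeroI.
by split; [exact: subIsetl|move=> CCA; apply: nCA => v /CCA[]].
Qed.

Lemma cell_inj C D : cell C -> cell D -> filt C D -> filt D C -> C = D.
Proof.
move=> cC cD /(filt_cell cC cD.1) CD /(filt_cell cD cC.1) DC.
by apply/seteqP.
Qed.

Lemma emit_bigcup (A : set V) :
  @emit G A = \bigcup_(v in A) @emit G [set v].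
Proof.
apply/seteqP; split=> [e Ae|e [v Av ev]]; first by exists (src e).
by rewrite /emit /= (ev : src e = v).
Qed.

(** Each vertex of an infinite cell emits finitely many edges, because its
    singleton is a proper subset; so the finitely many vertices of [C] outside
    [A] do too. *)
Lemma filt_emit C A : cell C -> filt C A -> finite_set (@emit G (C `\` A)).
Proof.
case=> gC [[v ->] /filt1 Av|[Cinf Cmin] [CA _]].
  by apply: sub_finite_set (@finite_set0 _) => e [/= ->].
rewrite emit_bigcup; apply: bigcup_finite => // v [Cv _].
apply: (Cmin _ (gzero1 v) _).2; split=> [_ ->//|Csub].
by apply: Cinf; exact: sub_finite_set Csub (finite_set1 v).
Qed.

(** A finite infinite emitter contains a vertex emitting infinitely many
    edges, and minimality makes it equal to that singleton. *)
Lemma min_inf_emitter_cell C : @min_inf_emitter G C -> cell C.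
Proof.
case=> gC eC minE minF; split=> //; have [fC|] := EM (finite_set C); last first.
  right; split=> // D gD DC.
  have fD : finite_set (@emit G D) by apply: contrapT; exact: minE.
  by split => //; apply: contrapT => infD; apply: minF DC _.
left; move: eC; rewrite emit_bigcup => eC.
have [v [Cv ev]] : exists v, C v /\ infinite_set (@emit G [set v]).
  apply: contrapT => nex; apply: eC; apply: bigcup_finite => // v Cv.
  by apply: contrapT => ?; apply: nex; exists v.
exists v; apply: contrapT => Cneq; apply: (minE [set v]) => //.
  exact: gzero1.
by split=> [_ ->//|Csub]; apply: Cneq; apply/seteqP; split=> // _ ->.
Qed.

Lemma min_sink_cell C : @min_sink G C -> cell C.
Proof.
case=> gC infC fC minC; split=> //; right; split=> // D gD DC.
split; first by apply: contrapT; exact: minC.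
by apply: sub_finite_set fC => e; exact: DC.1.
Qed.

(** The cells that can end a boundary point of finite length: a path cannot
    stop at a regular vertex. *)
Definition terminal (C : set V) : Prop :=
  cell C /\ forall v, C = [set v] -> ~ @regular G v.

Lemma infinite_cell C : cell C -> infinite_set C ->
  @min_sink G C \/ @min_inf_emitter G C.
Proof.
case=> gC [[v ->] /(_ (finite_set1 v))//|[_ Cmin] Cinf].
have [fC|eC] := EM (finite_set (@emit G C)); [left|right]; split=> //.
- by move=> D gD /(Cmin D gD)[fD _] infD; exact: infD.
- by move=> D gD /(Cmin D gD)[_ fD] infD; exact: infD.
- by move=> D gD /(Cmin D gD)[fD _] [_ infD]; exact: infD.
Qed.

Lemma emit_neq0 v : ~ @sink G v <-> @emit G [set v] !=set0.
Proof.
by rewrite /sink; split=> [/eqP/set0P//|]; move=> /set0P/eqP.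
Qed.

Lemma xfinE a (C : set V) :
  xfin (FinPoint a C) <-> [/\ lstar a, C `<=` path_rng a & terminal C].
Proof.
split.
  have reg v : C = [set v] -> @regular G v ->
      finite_set (@emit G C) /\ ~ @sink G v.
    by move=> -> [ev fv]; split=> //; exact/emit_neq0.
  case=> -[[la gC Ca] mC]; split=> //; split.
  - exact: min_inf_emitter_cell.
  - by move=> v Cv /(reg _ Cv)[fv _]; case: mC => _ + _ _; exact.
  - case: mC => [[v _ ->]|]; last exact: min_sink_cell.
    by split; [exact: gzero1|left; exists v].
  - move=> v Cv /(reg _ Cv)[_]; apply; case: mC => [[u su Cu]|[_ infC]].
      by have <- : u = v by have : [set v] u by rewrite -Cv Cu.
    by case: infC; rewrite Cv; exact: finite_set1.
case=> la Ca [cC nreg]; have gC := cC.1.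
case: (cC) => _ [[v Cv]|[Cinf _]]; last first.
  by case: (infinite_cell cC Cinf) => mC; [right|left]; split=> //; right.
have [sv|nsv] := EM (@sink G v); first by right; split=> //; left; exists v.
left; split=> //; split=> //.
- by rewrite Cv => fv; apply: (nreg v) => //; split=> //; exact/emit_neq0.
- move=> D gD; rewrite Cv => Dv.
  have -> : D = set0.
    rewrite -subset0 => u Du; have uv := Dv.1 u Du; apply: Dv.2 => _ ->.
    by rewrite -uv.
  by apply; apply: sub_finite_set (@finite_set0 _) => e.
- move=> D gD; rewrite Cv => Dv [_]; apply.
  exact: sub_finite_set Dv.1 (finite_set1 v).
Qed.

(** A terminal cell strictly inside a terminal cell is finite with finitely
    many edges, hence one vertex that is not regular: a sink. This is why the
    sets D_(b,B),F,S mention the sinks of [B] separately. *)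
Lemma terminal_sub C D : terminal C -> terminal D -> C `<=` D ->
  C = D \/ exists2 v, C = [set v] & @sink G v.
Proof.
move=> [cC Creg] [cD _] CD; have [->|CneD] := EM (C = D); [by left|right].
have CltD : C `<` D.
  by split=> // DC; apply: CneD; apply/seteqP.
case: (cD) => _ [[u Du]|[_ /(_ _ cC.1 CltD)[fC eC]]].
  case: CneD; have [v Cv] := cell_neq0 cC; rewrite Du in CD *.
  by apply/seteqP; split=> // _ ->; rewrite -(CD v Cv).
case: cC => _ [[v Cv]|[/(_ fC)//]]; exists v => //.
apply: contrapT => nsv; apply: (Creg v Cv); split; first exact/emit_neq0.
by rewrite -Cv.
Qed.

(** * The semilattice and its filters *)

Local Notation ele := (option (seq E * set V)).

(** The order of the semilattice on nonzero elements, computed from its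
    product ([es_leP]). *)
Definition below (a : seq E) (A : set V) (b : seq E) (B : set V) : Prop :=
  a = b /\ A `<=` B \/ exists2 e, B (src e) & begins (rcons b e) (FinWord a).

Lemma es_leP a A b B : es (Some (a, A)) -> es (Some (b, B)) ->
  es_le (Some (a, A)) (Some (b, B)) <-> below a A b B.
Proof.
move=> [la A0 [bA Aa]] [lb B0 [bB Bb]]; rewrite /es_le /es_mul; split.
- case: asboolP => [[bE ne] [ba AB]|_].
    left; split=> // v; rewrite -AB ba drop_size /= => -[].
    by [].
  case: asboolP => // -[]; case: (drop _ _) => [|e d] aE ne [AE].
    by left; split; [rewrite aE cats0|move=> v; rewrite -AE => -[]].
  right; exists e; last by exists d; rewrite cat_rcons.
  case: A0 => v; rewrite -AE => -[_] /=; case: ifPn => // /set_mem.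
  by [].
- case=> [[-> AB]|[e Be [d aE]]].
    rewrite drop_size cats0 /=.
    have -> : A `&` B = A by apply/setIidPl.
    by rewrite asboolT.
  have {}aE : a = b ++ e :: d by rewrite aE cat_rcons.
  rewrite asboolF; last first.
    case=> ba _; have : begins a (FinWord b) by exists (drop (size a) b).
    by move=> /begins_size; rewrite aE size_cat /= addnS ltnNge leq_addr.
  have -> : drop (size b) a = e :: d by rewrite aE drop_size_cat.
  have rE : A `&` rel_rng B (e :: d) = A.
    apply/setIidPl; rewrite /rel_rng mem_set//.
    by rewrite aE path_rng_cat in Aa.
  by rewrite rE asboolT.
Qed.

Lemma es_src b e : @lstar G (rcons b e) -> es (Some (b, [set src e])).
Proof.
move=> /lstar_rcons[lb be]; split=> //; first by exists (src e).
by split; [exact: bfam1|move=> _ ->].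
Qed.

Lemma es_rng b e : @lstar G (rcons b e) -> es (Some (rcons b e, rng e)).
Proof.
move=> lbe; split=> //; first exact: rng_neq0.
by split; [apply: gzero_bfam; exact: gzero_rng|rewrite path_rng_rcons].
Qed.

Definition occurs (xi : set ele) (b : seq E) : Prop :=
  exists A, xi (Some (b, A)).

Definition is_filter (xi : set ele) := poset_filter (@es G) (@es_le G) None xi.

Section Filter.
Variables (xi : set ele) (Fxi : is_filter xi).

Lemma filter_es p : xi p -> es p.
Proof. by case: Fxi => h _ _ _ _; exact: h. Qed.

Lemma filter_up a A b B :
  xi (Some (a, A)) -> es (Some (b, B)) -> below a A b B -> xi (Some (b, B)).
Proof.
move=> aA bB lt; case: Fxi => _ _ up _ _; apply: up (aA) (bB) _.
by apply/es_leP => //; exact: filter_es.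
Qed.

Lemma filter_lower a A b B : xi (Some (a, A)) -> xi (Some (b, B)) ->
  exists c C, [/\ xi (Some (c, C)), below c C a A & below c C b B].
Proof.
move=> aA bB; case: (Fxi) => _ _ _ /(_ _ _ aA bB)[[[c C]|] [xc ca cb]] x0 //.
by exists c, C; split=> //; apply/es_leP => //; exact: filter_es.
Qed.

Lemma occurs_lstar b : occurs xi b -> lstar b.
Proof. by case=> A /filter_es[]. Qed.

Lemma occurs_prefix b c : occurs xi (b ++ c) -> occurs xi b.
Proof.
case: c => [|e c]; first by rewrite cats0.
move=> oc; have := occurs_lstar oc.
rewrite -cat_rcons => /lstar_prefix/es_src be.
exists [set src e]; case: oc => A xA; apply: filter_up xA be _.
by right; exists e => //; exists c; rewrite cat_rcons.
Qed.

Lemma occurs_nil : occurs xi [::].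
Proof.
case: (Fxi) => _ [[[a A]|] xa] _ _ x0 //; apply: (@occurs_prefix _ a).
by exists A.
Qed.

(** Along the word of a filter, membership is decided by the next edge. Hence
    a filter is determined by its word together with, when that word is
    finite, the sets it contains at the end of the word. *)
Lemma filter_edge b e A : occurs xi (rcons b e) -> es (Some (b, A)) ->
  xi (Some (b, A)) <-> A (src e).
Proof.
move=> [D xD] bA; split=> [xA|Ae]; last first.
  by apply: filter_up xD bA _; right; exists e => //; exact: begins_refl.
have [c [C [xC cbe cb]]] := filter_lower xD xA.
have {cbe} bec : begins (rcons b e) (FinWord c).
  case: cbe => [[-> _]|[f _ /begins_rcons//]].
  exact: begins_refl.
case: cb => [[cE _]|[f Af /(begins_next bec)->//]].
by move/begins_size: bec; rewrite cE size_rcons ltnn.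
Qed.

Lemma filterI b A B :
  xi (Some (b, A)) -> xi (Some (b, B)) -> xi (Some (b, A `&` B)).
Proof.
move=> xA xB; have [lb _ [bA Ab]] := filter_es xA.
have [_ _ [bB _]] := filter_es xB.
have [c [C [xC cA cB]]] := filter_lower xA xB.
have bAB : A `&` B !=set0 -> es (Some (b, A `&` B)).
  by split=> //; split; [exact: bfamI|move=> v [/Ab]].
case: cA cB => [[cb CA]|[e Ae be]] [[cb' CB]|[f Bf bf]].
- have CAB : C `<=` A `&` B by move=> v Cv; split; [exact: CA|exact: CB].
  apply: filter_up (xC) _ _; last by left.
  by apply: bAB; have [_ [v Cv] _] := filter_es xC; exists v; exact: CAB.
- by move/begins_size: bf; rewrite cb size_rcons ltnn.
- by move/begins_size: be; rewrite cb' size_rcons ltnn.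
- have fe := begins_next bf be; rewrite {f bf}fe in Bf.
  by apply: filter_up xC (bAB _) _; [exists (src e)|right; exists e].
Qed.

Lemma occurs_total b c : occurs xi b -> occurs xi c ->
  (size b <= size c)%N -> begins b (FinWord c).
Proof.
move=> [B xB] [C xC] lebc; have [d [D [_ db dc]]] := filter_lower xB xC.
have pre (a : seq E) A : below d D a A -> begins a (FinWord d).
  by case=> [[-> _]|[e _ /begins_rcons//]]; exact: begins_refl.
exact: begins_total (pre _ _ db) (pre _ _ dc) lebc.
Qed.

(** The words occurring in a filter form a chain closed under beginnings.
    Either one of them cannot be extended, and it is the word of the filter,
    or extending step by step produces an infinite path. *)
Lemma filter_word : exists w, assoc_word xi w.
Proof.
have [[a [oa na]]|ext] :=
    EM (exists a, occurs xi a /\ forall e, ~ occurs xi (rcons a e)).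
  exists (FinWord a); split; first exact: occurs_lstar.
  move=> b; split=> [ob|[c aE]]; last first.
    by apply: (@occurs_prefix _ c); rewrite -aE.
  have [/(occurs_total ob oa)//|ab] := leqP (size b) (size a).
  have [c bE] := occurs_total oa ob (ltnW ab).
  case: c => [|e c] in bE; first by move: ab; rewrite bE cats0 ltnn.
  by case: (na e); apply: (@occurs_prefix _ c); rewrite cat_rcons -bE.
have next b : occurs xi b -> exists e, occurs xi (rcons b e).
  move=> ob; apply: contrapT => nb; apply: ext; exists b; split=> // e be.
  by apply: nb; exists e.
have [e0 _] := next _ occurs_nil.
have /choice[f fP] : forall b, exists e, occurs xi b -> occurs xi (rcons b e).
  by move=> b; have [/next[e]|] := EM (occurs xi b); [exists e|exists e0].
pose b n := iter n (fun c => rcons c (f c)) [::].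
pose x n := f (b n).
have bE n : b n = mkseq x n by elim: n => [//|n IHn]; rewrite mkseqS -IHn.
have ob n : occurs xi (mkseq x n).
  by rewrite -bE; elim: n => [|n IHn]; [exact: occurs_nil|exact: fP].
exists (InfWord x); split.
  move=> n; have /occurs_lstar := ob n.+2; rewrite mkseqS => /lstar_rcons[_].
  by rewrite mkseqS path_rng_rcons.
move=> c; split=> [oc|/= ->]; last exact: ob.
have := occurs_total oc (ob (size c)); rewrite size_mkseq => /(_ (leqnn _)).
by move=> /begins_trans; apply; exact: begins_mkseq.
Qed.

Lemma word_ofE w : assoc_word xi w -> word_of xi = w.
Proof.
move=> [pw aw]; apply: xget_unique => // w' [_ aw']; apply: word_inj => b.
by rewrite -aw -aw'.
Qed.

End Filter.

(** * The inverse map *)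

(** The inverse of [Phi]: the first case applies to the words [b] that [y]
    continues, the second to the word at which [y] ends. *)
Definition Phi_inv (y : xpoint G) : set ele :=
  [set p | es p /\ if p is Some (b, A) then
    (exists2 e, A (src e) & begins (rcons b e) (point_word y)) \/
    (exists2 C, filt C A & y = FinPoint b C) else False].

Lemma boundaryE (y : xpoint G) : boundary G y <->
  path_word (point_word y) /\
  (if y is FinPoint a C then C `<=` path_rng a /\ terminal C else True).
Proof.
case: y => [x|a C]; rewrite /boundary /=; first by split=> [[//|[]//]|[]]; left.
by split=> [[//|/xfinE[]//]|[la [Ca tC]]]; right; apply/xfinE.
Qed.

Lemma Phi_inv_edge y b e A : begins (rcons b e) (point_word y) ->
  es (Some (b, A)) -> Phi_inv y (Some (b, A)) <-> A (src e).
Proof.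
move=> be bA; split=> [[_ [[f Af bf]|[C _ yE]]]|Ae].
- by rewrite (begins_next be bf).
- by move: be; rewrite yE => /begins_irrefl.
- by split=> //; left; exists e.
Qed.

Lemma Phi_inv_end b C A : es (Some (b, A)) ->
  Phi_inv (FinPoint b C) (Some (b, A)) <-> filt C A.
Proof.
move=> bA; split=> [[_ [[f Af /begins_irrefl//]|[D CD [->//]]]]|CA].
by split=> //; right; exists C.
Qed.

Lemma Phi_inv_begins y b A : Phi_inv y (Some (b, A)) -> begins b (point_word y).
Proof.
case=> _ [[e _ /begins_rcons//]|[C _ -> /=]]; exact: begins_refl.
Qed.

Lemma es_cell b C : @lstar G b -> C `<=` path_rng b -> cell C ->
  es (Some (b, C)).
Proof.
move=> lb Cb cC; split=> //; first exact: cell_neq0.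
by split=> //; apply: gzero_bfam; exact: cC.1.
Qed.

Lemma Phi_inv_occurs y b : boundary G y ->
  occurs (Phi_inv y) b <-> begins b (point_word y).
Proof.
move=> /boundaryE[py yb]; split=> [[A /Phi_inv_begins//]|yb'].
have [yE|[e be]] := begins_split yb'.
  case: y => // a C in py yb yE yb' *; case: yE => yE; subst b; exists C.
  apply/Phi_inv_end; first by apply: es_cell (py) yb.1 yb.2.1.
  exact: filt_self (cell_neq0 yb.2.1).
have lbe := begins_lstar py be; exists [set src e].
by apply/(Phi_inv_edge be) => //; exact: es_src.
Qed.

Lemma Phi_inv_filter y : boundary G y -> is_filter (Phi_inv y).
Proof.
move=> yb; split.
- by move=> p [].
- have /(Phi_inv_occurs _ yb)[A yA] := begins_nil (point_word y).
  by exists (Some ([::], A)).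
- move=> [[a A]|] [[b B]|] [esp yA] esq //; rewrite es_leP//.
  case=> [[ab AB]|[e Be /begins_trans ab]]; last first.
    split=> //; left; exists e => //; apply: ab.
    exact: (Phi_inv_begins (conj esp yA : Phi_inv y (Some (a, A)))).
  rewrite -ab; split; first by rewrite ab.
  case: yA => [[e Ae be]|[C CA yE]].
    by left; exists e => //; exact: AB.
  by right; exists C => //; exact: filtS AB CA.
- move=> [[a A]|] [[b B]|] yA yB; try by case: yA yB => _ + [_].
  wlog le_ab : a A b B yA yB / (size a <= size b)%N.
    move=> wl; have [/wl|/ltnW/wl] := leqP (size a) (size b); first exact.
    by move=> /(_ _ _ yB yA)[z [? ? ?]]; exists z.
  have [ab_eq|ne_ab] := EM (a = b).
    subst b.
    have [la _ [bA Aa]] := yA.1; have [_ _ [bB Bb]] := yB.1.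
    have yAB : (A `&` B !=set0 -> es (Some (a, A `&` B))).
      by split=> //; split; [exact: bfamI|move=> v [/Aa]].
    suff yI : Phi_inv y (Some (a, A `&` B)).
      exists (Some (a, A `&` B)); split=> //.
        by apply/(es_leP yI.1 yA.1); left; split=> // v [].
      by apply/(es_leP yI.1 yB.1); left; split=> // v [].
    have [yE|[e ae]] := begins_split (Phi_inv_begins yA); last first.
      have Ae := (Phi_inv_edge ae yA.1).1 yA.
      have Be := (Phi_inv_edge ae yB.1).1 yB.
      by apply/(Phi_inv_edge ae) => //; apply: yAB; exists (src e).
    case: y => // a' C in yb yA yB yE *; case: yE => aa'; subst a'.
    have [_ [_ [cC _]]] := (boundaryE _).1 yb.
    have CA := (Phi_inv_end _ yA.1).1 yA; have CB := (Phi_inv_end _ yB.1).1 yB.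
    have CAB := filtI cC CA CB.
    by apply/Phi_inv_end => //; apply: yAB; have [_ [v []]] := CAB; exists v.
  have [c bE] := begins_total (Phi_inv_begins yA) (Phi_inv_begins yB) le_ab.
  case: c => [|e c] in bE; first by case: ne_ab; rewrite bE cats0.
  have ae : begins (rcons a e) (FinWord b) by exists c; rewrite cat_rcons.
  have ye := begins_trans ae (Phi_inv_begins yB).
  exists (Some (b, B)); split=> //.
    apply/(es_leP yB.1 yA.1); right; exists e => //.
    exact: (Phi_inv_edge ye yA.1).1.
  by apply/(es_leP yB.1 yB.1); left; split.
- by case.
Qed.

Lemma Phi_inv_assoc_word y :
  boundary G y -> assoc_word (Phi_inv y) (point_word y).
Proof.
move=> yb; split; first by have [] := (boundaryE y).1 yb.
by move=> b; exact: Phi_inv_occurs.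
Qed.

(** The ultrafilter of sets below the range of [a] that [phi] sends to the
    cell [C]. *)
Definition ult (a : seq E) (C : set V) : set (set V) :=
  [set D | balg a D /\ filt C D].

Lemma ult_ultrafilter a C : cell C -> C `<=` path_rng a ->
  poset_ultrafilter (balg a) subset set0 (ult a C).
Proof.
move=> cC Ca; have bC : balg a C.
  by split=> //; apply: gzero_bfam; exact: cC.1.
split=> [|F [Fb _ _ Fdir F0] CF].
  split.
  - by move=> D [].
  - by exists C; split=> //; exact: filt_self (cell_neq0 cC).
  - by move=> A B [_ CA] bB AB; split=> //; exact: filtS CA.
  - move=> A B [bA CA] [bB CB]; exists (A `&` B); split=> [|v []//|v []//].
    split; last exact: filtI.
    by split; [exact: bfamI bA.1 bB.1|move=> v [/bA.2]].
  - by case=> _ [_ [v []]].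
apply/seteqP; split=> // D FD; split; first exact: Fb.
have [//|CnD] := filt_dichotomy cC (Fb _ FD).1.
have FCD : F (C `\` D).
  apply: CF; split; last exact: filtI (filt_self (cell_neq0 cC)) CnD.
  by split; [exact: bfamD bC.1 (Fb _ FD).1|move=> v [/Ca]].
have [Z [FZ ZD ZCD]] := Fdir _ _ FD FCD; case: F0.
suff <- : Z = set0 by [].
by rewrite -subset0 => v Zv; have [_] := ZCD v Zv; apply; exact: ZD.
Qed.

Lemma phi_graphE a U C : phi_graph a U C <->
  [/\ cell C, C `<=` path_rng a & U = ult a C].
Proof.
split=> [[_ [[v [av -> ->]]|[mC infC Ca ->]]]|[cC Ca ->]].
- split=> [|u ->//|]; first by split; [exact: gzero1|left; exists v].
  by apply/seteqP; split=> D [bD] /filt1.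
- have cC : cell C by case: mC => [/min_sink_cell|/min_inf_emitter_cell].
  have bC := gzero_bfam cC.1.
  split=> //; apply/seteqP; split=> D [bD].
    case=> A [bA fA CAD]; split=> //; apply/filt_infinite => //.
    apply: sub_finite_set fA => v [Cv nDv].
    by apply: contrapT => nAv; apply/nDv/CAD.
  case=> CD _; split=> //; exists (C `\` D); split=> //.
    by split; [exact: bfamD bC bD.1|move=> v [/Ca]].
  by rewrite setDD => v [].
- split; first exact: ult_ultrafilter.
  have [fC|infC] := EM (finite_set C).
    case: (cC) => _ [[v Cv]|[/(_ fC)//]]; left; exists v; split=> //.
      by apply: Ca; rewrite Cv.
    by rewrite Cv; apply/seteqP; split=> D [bD] /filt1.
  right; split=> //; first exact: infinite_cell.
  have bC := gzero_bfam cC.1.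
  apply/seteqP; split=> D [bD].
    case=> CD _; split=> //; exists (C `\` D); split=> //.
      by split; [exact: bfamD bC bD.1|move=> v [/Ca]].
    by rewrite setDD => v [].
  case=> A [bA fA CAD]; split=> //; apply/filt_infinite => //.
  apply: sub_finite_set fA => v [Cv nDv].
  by apply: contrapT => nAv; apply/nDv/CAD.
Qed.

Lemma phi_ult a C : cell C -> C `<=` path_rng a -> phi a (ult a C) = C.
Proof.
move=> cC Ca; apply: xget_unique; first exact/phi_graphE.
move=> D /phi_graphE[cD Da CD].
have bcell B : cell B -> B `<=` path_rng a -> ult a B B.
  move=> cB Ba; split; last exact: filt_self (cell_neq0 cB).
  by split=> //; apply: gzero_bfam; exact: cB.1.
apply: cell_inj => //.
  by have := bcell _ cC Ca; rewrite CD => -[].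
by have := bcell _ cD Da; rewrite -CD => -[].
Qed.

Lemma slice_Phi_inv a C : boundary G (FinPoint a C) ->
  slice (Phi_inv (FinPoint a C)) a = ult a C.
Proof.
move=> /boundaryE[la [Ca [cC _]]]; apply/seteqP; split=> D.
  move=> [_ yD]; have [_ _ bD] := yD.1.
  by split=> //; exact: (Phi_inv_end _ yD.1).1 yD.
case=> bD CD; split; first exact: bD.1.
apply/Phi_inv_end => //; split=> //.
by have [_ [v []]] := CD; exists v.
Qed.

Lemma Phi_invK y : boundary G y -> Phi (Phi_inv y) = y.
Proof.
move=> yb; rewrite /Phi (word_ofE (Phi_inv_assoc_word yb)).
case: y yb => [//|a C] yb /=; rewrite slice_Phi_inv// phi_ult//.
  by have [_ [_ []]] := (boundaryE _).1 yb.
by have [_ []] := (boundaryE _).1 yb.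
Qed.

(** * Ultrafilters and approximation *)

Definition is_ultra (xi : set ele) :=
  poset_ultrafilter (@es G) (@es_le G) None xi.

Lemma below_trans a A b B c C :
  below a A b B -> below b B c C -> below a A c C.
Proof.
case=> [[-> AB]|[e Be be]] [[bc BC]|[f Cf cf]].
- by left; split=> // v /AB/BC.
- by right; exists f.
- by right; exists e; [exact: BC|rewrite -bc].
- by right; exists f => //; exact: begins_trans cf (begins_rcons be).
Qed.

Lemma below_begins a A b B : below a A b B -> begins b (FinWord a).
Proof. by case=> [[-> _]|[e _ /begins_rcons//]]; exact: begins_refl. Qed.

(** Two elements with a nonzero lower bound have comparable words; the meet is
    the intersection if the words are equal, and the element with the longer
    word otherwise. *)
Lemma es_meet a A b B c C :
  es (Some (a, A)) -> es (Some (b, B)) -> es (Some (c, C)) ->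
  below c C a A -> below c C b B ->
  exists d D, [/\ es (Some (d, D)), below d D a A, below d D b B &
    forall c' C', below c' C' a A -> below c' C' b B -> below c' C' d D].
Proof.
wlog le_ab : a A b B / (size a <= size b)%N.
  move=> wl aA bB cC ca cb; have [le_ab|/ltnW le_ba] := leqP (size a) (size b).
    exact: wl ca cb.
  have [d [D [? ? ? h]]] := wl _ _ _ _ le_ba bB aA cC cb ca.
  by exists d, D; split=> // ? ? ? ?; exact: h.
move=> aA bB cC ca cb.
have [d bE] := begins_total (below_begins ca) (below_begins cb) le_ab.
case: d => [|e d] in bE; last first.
  have ae : begins (rcons a e) (FinWord b) by exists d; rewrite cat_rcons.
  have Ae : A (src e).
    have ce := begins_trans ae (below_begins cb).
    case: ca => [[ca _]|[f Af af]]; last by rewrite (begins_next ce af).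
    by move: ce; rewrite ca => /begins_irrefl.
  by exists b, B; split=> //; [right; exists e|left; split].
rewrite cats0 in bE; subst b; exists a, (A `&` B); split.
- have [la _ [bA Aa]] := aA; have [_ _ [bB' _]] := bB.
  split=> //; last by split; [exact: bfamI|move=> v [/Aa]].
  case: ca cb => [[ca CA]|[e Ae ae]] [[ca' CB]|[f Bf af]].
  + by have [_ [v Cv] _] := cC; exists v; split; [exact: CA|exact: CB].
  + by move: af; rewrite ca => /begins_irrefl.
  + by move: ae; rewrite ca' => /begins_irrefl.
  + by exists (src e); split=> //; rewrite (begins_next ae af).
- by left; split=> // v [].
- by left; split=> // v [].
- move=> c' C' [[-> CA]|[e Ae ae]] [[ca' CB]|[f Bf af]].
  + by left; split=> // v Cv; split; [exact: CA|exact: CB].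
  + by move/begins_irrefl: af.
  + by move: ae; rewrite ca' => /begins_irrefl.
  + by right; exists e => //; split=> //; rewrite (begins_next ae af).
Qed.

(** Maximality in the form used below: an element compatible with all of an
    ultrafilter belongs to it, since the elements above the meets of [(a, A)]
    with members of [eta] form a filter containing [eta]. *)
Lemma ultra_mem eta a A : is_ultra eta -> es (Some (a, A)) ->
  (forall b B, eta (Some (b, B)) ->
     exists c C, [/\ es (Some (c, C)), below c C a A & below c C b B]) ->
  eta (Some (a, A)).
Proof.
move=> [Feta max] aA compat.
pose F := [set p | es p /\ if p is Some (d, D) then
   exists b B, eta (Some (b, B)) /\ forall c C,
     below c C a A -> below c C b B -> below c C d D else False].
have [_ [[[b0 B0]|] eta0] _ _ N0] := Feta => //.
suff FF : is_filter F.
  rewrite -(max F FF); last first.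
    move=> [[d D]|] // etad; split; first exact: (filter_es Feta).
    by exists d, D.
  by split=> //; exists b0, B0.
split.
- by move=> p [].
- by exists (Some (a, A)); split=> //; exists b0, B0.
- move=> [[d D]|] [[d' D']|] [] // dD [b [B [etab h]]] dD'.
  rewrite es_leP// => dd'; split=> //; exists b, B; split=> // c C ca cb.
  exact: below_trans (h _ _ ca cb) dd'.
- move=> [[d D]|] [[d' D']|] [] // dD [b [B [etab h]]] [] // dD'
    [b' [B' [etab' h']]].
  have [b2 [B2 [eta2 b2b b2b']]] := filter_lower Feta etab etab'.
  have [c [C [cC ca cb]]] := compat _ _ eta2.
  have [m [M [mM ma mb glb]]] := es_meet aA (filter_es Feta eta2) cC ca cb.
  exists (Some (m, M)); split.
  + by split=> //; exists b2, B2.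
  + by apply/es_leP => //; apply: h ma (below_trans mb b2b).
  + by apply/es_leP => //; apply: h' ma (below_trans mb b2b').
- by case.
Qed.

(** Zorn's lemma. It is applied to the sets [X] whose union with the principal
    filter [F0] is a filter, rather than to filters, so that the empty chain
    has an upper bound. *)
Lemma ultra_exists a A : es (Some (a, A)) ->
  exists2 eta, is_ultra eta & eta (Some (a, A)).
Proof.
move=> aA.
pose F0 : set ele := [set p | es p /\ es_le (Some (a, A)) p].
have aa : below a A a A by left; split.
have F0a : F0 (Some (a, A)) by split=> //; apply/es_leP.
have F0F : is_filter F0.
  split; first by move=> p [].
  - by exists (Some (a, A)).
  - move=> [[b B]|] [[c C]|] [] // bB /es_leP ab cC /es_leP bc.
    by split=> //; apply/es_leP => //; apply: below_trans (ab _ _) (bc _ _).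
  - by move=> p q [ep ap] [eq aq]; exists (Some (a, A)).
  - by case=> _; rewrite /es_le.
have [X [FX maxX]] : exists X, is_filter (X `|` F0) /\
    forall Y, X `<` Y -> ~ is_filter (Y `|` F0).
  apply: (@Zorn_bigcup _ (fun X => is_filter (X `|` F0))) => K KF Ktot.
  have KU X p : K X -> (X `|` F0) p -> (\bigcup_(X in K) X `|` F0) p.
    by move=> KX [Xp|]; [left; exists X|right].
  have UK p : (\bigcup_(X in K) X `|` F0) p ->
      F0 p \/ exists2 X, K X & (X `|` F0) p.
    by case=> [[X KX Xp]|]; [right; exists X => //; left|left].
  split.
  - by move=> p /UK[[]//|[X /KF[+ _ _ _ _]]]; exact.
  - by exists (Some (a, A)); right.
  - move=> p q /UK[F0p|[X KX Xp]] eq pq.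
      by right; case: F0F => _ _ up _ _; exact: up F0p eq pq.
    by apply: (KU _ _ KX); have [_ _ up _ _] := KF _ KX; exact: up Xp eq pq.
  - suff dir p q X : K X -> (X `|` F0) p -> (X `|` F0) q ->
        exists z, [/\ (\bigcup_(X in K) X `|` F0) z, es_le z p & es_le z q].
      move=> p q /UK[F0p|[X KX Xp]] /UK[F0q|[Y KY Yq]].
      + case: F0F => _ _ _ /(_ _ _ F0p F0q)[z [F0z zp zq]] _.
        by exists z; split=> //; right.
      + by apply: (dir _ _ Y) => //; right.
      + by apply: (dir _ _ X) => //; right.
      + have [XY|YX] := Ktot _ _ KX KY.
          by apply: (dir _ _ Y) => //; case: Xp => [/XY|]; [left|right].
        by apply: (dir _ _ X) => //; case: Yq => [/YX|]; [left|right].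
    move=> KX Xp Xq; have [_ _ _ /(_ _ _ Xp Xq)[z [Xz zp zq]] _] := KF _ KX.
    by exists z; split=> //; exact: KU KX Xz.
  - case/UK => [|[X /KF[_ _ _ _]]//].
    by case: F0F.
exists (X `|` F0); last by right.
split=> // Y FY XY.
have YE : Y `|` F0 = Y by apply/setUidPl => p F0p; apply: XY; right.
have XsubY : X `<=` Y by move=> p Xp; apply: XY; left.
have [YX|nYX] := EM (Y `<=` X); last first.
  by case: (maxX Y) => //; rewrite YE.
by apply/seteqP; split=> // p /YX; left.
Qed.

(** A larger filter has the same word, and along an infinite word membership
    is decided by the edges. *)
Lemma Phi_inv_inf_ultra x :
  boundary G (InfPoint x) -> is_ultra (Phi_inv (InfPoint x)).
Proof.
move=> yb; split=> [|F FF yF]; first exact: Phi_inv_filter.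
have occ b : begins b (InfWord x) -> occurs F b.
  by move=> /(Phi_inv_occurs b yb)[B /yF FB]; exists B.
apply/seteqP; split=> // -[[b B]|] Fb; last by case: FF => _ _ _ _ /(_ Fb).
have ox : begins b (InfWord x).
  apply: (begins_trans _ (begins_mkseq x (size b))).
  apply: (occurs_total FF); rewrite ?size_mkseq//; first by exists B.
  exact: occ (begins_mkseq _ _).
have [//|[e be]] := begins_split ox.
apply/(@Phi_inv_edge (InfPoint x) _ _ _ be (filter_es FF Fb)).
exact/(filter_edge FF (occ _ be) (filter_es FF Fb)).
Qed.

(** No nonzero element lies strictly below [(a, [set v])] when [v] is a sink. *)
Lemma Phi_inv_sink_ultra a v : @sink G v -> boundary G (FinPoint a [set v]) ->
  is_ultra (Phi_inv (FinPoint a [set v])).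
Proof.
move=> sv yb; split=> [|F FF yF]; first exact: Phi_inv_filter.
have [la [av [cv _]]] := (boundaryE _).1 yb.
have esv := es_cell la av cv.
have yv : Phi_inv (FinPoint a [set v]) (Some (a, [set v])).
  by apply/Phi_inv_end => //; apply/filt1.
apply/seteqP; split=> // -[[b B]|] Fb; last by case: FF => _ _ _ _ /(_ Fb).
have [c [C [Fc ca cb]]] := filter_lower FF (yF _ yv) Fb.
have Fyv := Phi_inv_filter yb.
case: ca => [[ca Cv]|[e ev _]]; last first.
  suff : @emit G [set v] e by rewrite sv.
  exact: ev.
apply: (filter_up Fyv _ (filter_es FF Fb) cb); rewrite ca.
apply/Phi_inv_end; first by rewrite -ca; exact: (filter_es FF).
have [_ [u Cu] _] := filter_es FF Fc.
by apply/filt1; rewrite -(Cv u Cu).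
Qed.

(** Tightness freed of the topology; see [tight_approximable]. *)
Definition approximable (xi : set ele) : Prop := forall S : set ele,
  finite_set S -> exists2 eta, is_ultra eta & forall p, S p -> eta p <-> xi p.

Lemma ultra_approximable xi : is_ultra xi -> approximable xi.
Proof. by move=> ux S _; exists xi. Qed.

(** A filter is a limit of ultrafilters indexed by an infinite set as soon as
    each element of the semilattice is decided correctly by all but finitely
    many of them; [R i p] means that the index [i] decides [p] correctly. *)
Lemma approximable_family (T : Type) (I : set T) (R : T -> ele -> Prop) xi :
  infinite_set I -> (forall p, finite_set [set i | I i /\ ~ R i p]) ->
  (forall i, I i ->
     exists2 eta, is_ultra eta & forall p, R i p -> eta p <-> xi p) ->
  approximable xi.
Proof.
move=> Iinf Rfin IR S fS.
have fB : finite_set (\bigcup_(p in S) [set i | I i /\ ~ R i p]).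
  by apply: bigcup_finite.
have /infinite_setN0[i [Ii nB]] := infinite_setD Iinf fB.
have [eta ueta etaR] := IR _ Ii; exists eta => // p Sp; apply: etaR.
by apply: contrapT => nR; apply: nB; exists p.
Qed.

(** Membership in the ultrafilter of a cell is read off from all but finitely
    many of its vertices, and also from the sources of all but finitely many
    of the edges it emits. The approximation of the filters of points, and the
    openness of the sets of points whose filter contains a given element, both
    rest on this. *)
Lemma filt_exceptions C B : cell C -> bfam B ->
  finite_set [set v | C v /\ ~ (B v <-> filt C B)] /\
  finite_set [set e | @emit G C e /\ ~ (B (src e) <-> filt C B)].
Proof.
move=> cC bB; have [CB|CnB] := filt_dichotomy cC bB.
  split; [apply: sub_finite_set (CB.1)|apply: sub_finite_set (filt_emit cC CB)].
    by move=> v [Cv nBv]; split=> // Bv; apply: nBv.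
  by move=> e [Ce nBe]; split=> // Be; apply: nBe.
have nCB : ~ filt C B by move=> CB; exact: filtN CnB.
split; [apply: sub_finite_set (CnB.1)|apply: sub_finite_set (filt_emit cC CnB)].
  by move=> v [Cv nBv]; split=> // Bv; apply: nBv.
by move=> e [Ce nBe]; split=> // Be; apply: nBe.
Qed.

Lemma begins_FinWord_rcons (a b : seq E) e : begins b (FinWord (rcons a e)) ->
  begins b (FinWord a) \/ b = rcons a e.
Proof.
case=> c; elim/last_ind: c => [|c f _]; first by rewrite cats0; right.
by rewrite -rcons_cat => /rcons_inj[-> _]; left; exists c.
Qed.

(** If [C] emits infinitely many edges, the approximating ultrafilters are
    chosen with a word starting with [rcons a e], one for each edge [e]
    emitted by [C]. *)
Lemma Phi_inv_emitter_approximable a C : boundary G (FinPoint a C) ->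
  infinite_set (@emit G C) -> approximable (Phi_inv (FinPoint a C)).
Proof.
move=> yb eC; have [la [Ca [cC _]]] := (boundaryE _).1 yb.
have lae e : C (src e) -> @lstar G (rcons a e).
  by move=> Ce; apply/lstar_rcons; split=> //; exact: Ca.
(* The edge [e] decides [(b, B)] wrongly only if [b = a] and [e] is one of the
   finitely many exceptions for [B], or if [b] itself continues [a] by [e]. *)
apply: (@approximable_family _ (@emit G C) (fun e p => es p ->
  if p is Some (b, B) then (b = a -> (B (src e) <-> filt C B)) /\
    ~ begins (rcons a e) (FinWord b) else True)) => //.
- move=> [[b B]|]; last by apply: sub_finite_set (@finite_set0 E) => e [_ []].
  have [bB|nbB] := EM (es (Some (b, B))); last first.
    by apply: sub_finite_set (@finite_set0 E) => e [_]; apply => /nbB.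
  have [_ _ [bfB _]] := bB.
  have f1 := (filt_exceptions cC bfB).2.
  have f2 : finite_set [set e | begins (rcons a e) (FinWord b)].
    have [[e be]|nbe] := EM (exists e, begins (rcons a e) (FinWord b)).
      apply: sub_finite_set (finite_set1 e) => f bf.
      exact: begins_next bf be.
    by apply: sub_finite_set (@finite_set0 E) => e be; apply: nbe; exists e.
  have := conj f1 f2; rewrite -finite_setU; apply: sub_finite_set => e [Ce nR].
  apply: contrapT => nU; apply: nR => _.
  split=> [_|be]; last by apply: nU; right.
  by apply: contrapT => ?; apply: nU; left.
- move=> e Ce; have [eta ueta etae] := ultra_exists (es_rng (lae e Ce)).
  have Feta := ueta.1.
  have oe : occurs eta (rcons a e) by exists (rng e).
  exists eta => // -[[b B]|] R; last first.
    by split=> [|[]//]; case: Feta => _ _ _ _.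
  have [bB|nbB] := EM (es (Some (b, B))); last first.
    by split=> [/(filter_es Feta)//|[]].
  have {R}[Ra Rb] := R bB.
  have [ba|nba] := EM (begins b (FinWord a)); last first.
    split=> [etab|/Phi_inv_begins//]; exfalso.
    have ob : occurs eta b by exists B.
    have [le|/ltnW le] := leqP (size (rcons a e)) (size b).
      exact/Rb/(occurs_total Feta).
    have [//|bE] := begins_FinWord_rcons (occurs_total Feta ob oe le).
    by apply: Rb; rewrite bE; exact: begins_refl.
  have [[ab]|[f bf]] := begins_split ba.
    by subst b; rewrite (Phi_inv_end C bB) -Ra//; exact: filter_edge.
  rewrite (@Phi_inv_edge (FinPoint a C) b f B bf bB).
  apply: filter_edge => //; case: bf => c aE.
  apply: (@occurs_prefix _ Feta _ (rcons c e)).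
  by rewrite -rcons_cat -aE.
Qed.

(** If [C] is infinite and emits finitely many edges, all but finitely many of
    its vertices are sinks [v], and the filters of the points [FinPoint a [set
    v]] are ultrafilters. *)
Lemma Phi_inv_sinks_approximable a C : boundary G (FinPoint a C) ->
  finite_set (@emit G C) -> infinite_set C ->
  approximable (Phi_inv (FinPoint a C)).
Proof.
move=> yb eC infC; have [la [Ca [cC _]]] := (boundaryE _).1 yb.
have infS : infinite_set (C `&` [set v | @sink G v]).
  have := infinite_setD infC (finite_image (@src G) eC).
  apply: sub_infinite_set => v [Cv nv]; split=> //=.
  apply: contrapT => /emit_neq0[e ev]; apply: nv; exists e => //=.
  by rewrite /emit /= (ev : src e = v).
apply: (@approximable_family _ _ (fun v p => es p ->
  if p is Some (b, B) then b = a -> (B v <-> filt C B) else True) _ infS).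
- move=> [[b B]|]; last by apply: sub_finite_set (@finite_set0 V) => e [_ []].
  have [[_ _ [bfB _]]|nbB] := EM (es (Some (b, B))); last first.
    by apply: sub_finite_set (@finite_set0 V) => e [_]; apply => /nbB.
  apply: sub_finite_set ((filt_exceptions cC bfB).1) => v [[Cv _] nR].
  by split=> // Bv; apply: nR.
- move=> v [Cv sv].
  have vb : boundary G (FinPoint a [set v]).
    apply/boundaryE; split=> //; split; first by move=> _ ->; exact: Ca.
    split; first by split; [exact: gzero1|left; exists v].
    move=> u vu [/emit_neq0]; case.
    by have <- : v = u by have : [set u] v by rewrite -vu.
  exists (Phi_inv (FinPoint a [set v])); first exact: Phi_inv_sink_ultra.
  move=> [[b B]|] R; last by split=> -[].
  have [bB|nbB] := EM (es (Some (b, B))); last by split=> -[].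
  have [ba|nba] := EM (b = a).
    by have := R bB ba; subst b; rewrite !Phi_inv_end// filt1.
  by split=> -[_ [h|[D _ [ab]]]]; (try by case: nba); split=> //; left.
Qed.

Lemma Phi_inv_approximable y : boundary G y -> approximable (Phi_inv y).
Proof.
case: y => [x|a C] yb; first exact/ultra_approximable/Phi_inv_inf_ultra.
have [la [Ca [cC reg]]] := (boundaryE _).1 yb.
have [fC|] := EM (finite_set (@emit G C)); last first.
  exact: Phi_inv_emitter_approximable.
have [|infC] := EM (finite_set C); last exact: Phi_inv_sinks_approximable.
case: (cC) => _ [[v Cv] _|[//]]; subst C.
apply/ultra_approximable/Phi_inv_sink_ultra => //.
apply: contrapT => /emit_neq0 ev.
by apply: (reg v).
Qed.

(** * Every approximable filter comes from a boundary point *)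

Lemma filter_end_lower eta a b B D : is_filter eta ->
  (forall e, ~ occurs eta (rcons a e)) ->
  eta (Some (a, D)) -> eta (Some (b, B)) ->
  exists C, [/\ eta (Some (a, C)), C `<=` D & below a C b B].
Proof.
move=> Feta na aD bB; have [c [C [cC ca cb]]] := filter_lower Feta aD bB.
case: ca => [[ca CD]|[e _ [d cE]]]; first by subst c; exists C.
case: (na e); apply: (@occurs_prefix _ Feta _ d).
by rewrite -cE; exists C.
Qed.

Section Approximable.
Variables (xi : set ele) (Fxi : is_filter xi) (Axi : approximable xi).

(** The filter agrees with an ultrafilter on [(a, D)] and on the two pieces of
    [D]. If the word of this ultrafilter continues after [a], the source of
    the next edge selects the piece; if its word is [a], the piece is found by
    maximality. *)
Lemma approximable_prime a A D : bfam A -> xi (Some (a, D)) ->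
  xi (Some (a, D `&` A)) \/ xi (Some (a, D `\` A)).
Proof.
move=> bA xD; have [la [d Dd] [bD Da]] := filter_es Fxi xD.
have eI : D `&` A !=set0 -> es (Some (a, D `&` A)).
  by split=> //; split; [exact: bfamI|move=> v [/Da]].
have eD : D `\` A !=set0 -> es (Some (a, D `\` A)).
  by split=> //; split; [exact: bfamD|move=> v [/Da]].
have [|eta ueta etaE] :=
  Axi (S := [set Some (a, D); Some (a, D `&` A); Some (a, D `\` A)]).
  exact: finite_set3.
have Feta := ueta.1.
have etaD : eta (Some (a, D)) by apply/etaE => //; left; left.
rewrite -!etaE; [|by right|by left; right].
have [[e oe]|ne] := EM (exists e, occurs eta (rcons a e)).
  have De := (filter_edge Feta oe (filter_es Feta etaD)).1 etaD.
  have [Ae|nAe] := EM (A (src e)); [left|right].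
    by apply/(filter_edge Feta oe) => //; apply: eI; exists (src e).
  by apply/(filter_edge Feta oe) => //; apply: eD; exists (src e).
have {}ne e : ~ occurs eta (rcons a e) by move=> oe; apply: ne; exists e.
have [meetA|] := EM (forall B, eta (Some (a, B)) -> B `&` (D `&` A) !=set0).
  left; have {}eI : es (Some (a, D `&` A)).
    by apply: eI; have [v [_]] := meetA _ etaD; exists v.
  apply: ultra_mem => // b B etaB.
  have [C [etaC CD Cb]] := filter_end_lower Feta ne etaD etaB.
  have [_ _ [bC Ca]] := filter_es Feta etaC.
  exists a, (C `&` (D `&` A)); split.
  - split=> //; first exact: meetA.
    by split; [apply: bfamI => //; exact: bfamI|move=> v [/Ca]].
  - by left; split=> // v [].
  - by apply: below_trans Cb; left; split=> // v [].
move=> /existsNP[B /not_implyP[etaB nB]]; right.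
have etaBD := filterI Feta etaB etaD.
have sub : B `&` D `<=` D `\` A.
  by move=> v [Bv Dv]; split=> // Av; apply: nB; exists v.
have [_ [v BDv] _] := filter_es Feta etaBD.
by apply: (filter_up Feta etaBD); [apply: eD; exists v; exact: sub|left].
Qed.

(** Suppose the word stopped at [a] with the principal ultrafilter of a
    regular vertex [v]. As [v] emits finitely many edges [e], an ultrafilter
    approximates the filter on [(a, [set v])] and on all [(rcons a e, rng e)];
    it contains the first and none of the others. It cannot stop at [a],
    because [v] emits an edge, and it cannot continue, because its next edge
    would be one of these [e]. *)
Lemma approximable_not_regular a v : (forall e, ~ occurs xi (rcons a e)) ->
  xi (Some (a, [set v])) -> ~ @regular G v.
Proof.
move=> na xv [[e0 e0v] fv].
have [|eta ueta etaE] := Axi (S := [set Some (a, [set v])] `|`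
    (fun e => Some (rcons a e, @rng G e)) @` (@emit G [set v])).
  by rewrite finite_setU; split; [exact: finite_set1|exact: finite_image].
have Feta := ueta.1.
have etav : eta (Some (a, [set v])) by apply/etaE => //; left.
have nrng e : @emit G [set v] e -> ~ eta (Some (rcons a e, rng e)).
  move=> ev; rewrite etaE; last by right; exists e.
  by move=> xe; apply: (na e); exists (rng e).
have [[e oe]|ne] := EM (exists e, occurs eta (rcons a e)).
  have ev := (filter_edge Feta oe (filter_es Feta etav)).1 etav.
  apply: (nrng e ev); case: (oe) => D etaD.
  apply: (filter_up Feta etaD); first exact/es_rng/(occurs_lstar Feta).
  left; split=> //; rewrite -(path_rng_rcons a).
  by have [_ _ []] := filter_es Feta etaD.
have {}ne e : ~ occurs eta (rcons a e) by move=> oe; apply: ne; exists e.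
apply: (nrng e0 e0v).
have e0r : es (Some (rcons a e0, rng e0)).
  apply/es_rng/lstar_rcons; have [la _ [_ va]] := filter_es Fxi xv.
  by split=> //; exact: va.
apply: ultra_mem => // b B etaB.
have [C [etaC Cv Cb]] := filter_end_lower Feta ne etav etaB.
exists (rcons a e0), (rng e0); split=> //; first by left; split.
apply: below_trans Cb; right; exists e0; last exact: begins_refl.
have [_ [u Cu] _] := filter_es Feta etaC.
by rewrite (e0v : src e0 = v) -(Cv u Cu).
Qed.

Hypothesis hG : RFUM2 G.

Lemma RFUM2_cells e : exists k (A : nat -> set V),
  (forall n, (n < k)%N -> cell (A n)) /\ rng e = \bigcup_(n < k) A n.
Proof.
have [k [A [hA eA]]] := hG e; exists k, A; split=> // n /hA[||[v -> _]].
- exact: min_inf_emitter_cell.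
- exact: min_sink_cell.
- by split; [exact: gzero1|left; exists v].
Qed.

Lemma slice_rng_cell a e D : rng e `<=` path_rng a -> D `<=` rng e ->
  xi (Some (a, D)) -> exists2 K, cell K & xi (Some (a, K)).
Proof.
have [k [A [hA ->]]] := RFUM2_cells e => Aa.
suff cov m D' : (m <= k)%N -> D' `<=` \bigcup_(n < m) A n ->
    xi (Some (a, D')) -> exists2 K, cell K & xi (Some (a, K)).
  exact: cov (leqnn k).
elim: m D' => [|m IHm] D' mk Dsub xD.
  by have [_ [v /Dsub[]]] := filter_es Fxi xD.
have [xI|xD'] := approximable_prime (gzero_bfam (hA m mk).1) xD; last first.
  apply: IHm xD'; first exact: ltnW.
  move=> v [/Dsub[n /= nm Anv] nAv]; exists n => //=.
  by move: nm; rewrite ltnS leq_eqVlt => /orP[/eqP nm|//]; rewrite -nm in nAv.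
exists (A m); first exact: hA.
have [la _ _] := filter_es Fxi xD.
apply: (filter_up Fxi xI); last by left; split=> // v [].
by apply: es_cell => //; [move=> v Av; apply: Aa; exists m|exact: hA].
Qed.

(** At the end of a nonempty word the whole range of the last edge is covered
    by finitely many cells, by the condition on ranges, and primeness selects
    one. At the empty word there may be no largest set, so the covering
    property is propagated through the generation of the Boolean algebra: it
    passes to unions by primeness, and to subsets by its formulation. *)
Lemma slice_cell a D : xi (Some (a, D)) ->
  exists2 K, cell K & xi (Some (a, K)).
Proof.
elim/last_ind: a D => [|a e _] D xD; last first.
  have [_ _ [_ De]] := filter_es Fxi xD; rewrite path_rng_rcons in De.
  by apply: (slice_rng_cell _ De xD); rewrite path_rng_rcons.
have [_ _ [bD _]] := filter_es Fxi xD.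
pose M := [set D | bfam D /\ forall D', D' `<=` D -> xi (Some ([::], D')) ->
  exists2 K, cell K & xi (Some ([::], K))].
suff [_ MD] : M D by exact: MD xD.
have MU : setU_closed M.
  move=> A B [bA hA] [bB hB]; split=> [|D' D'AB xD']; first exact: bfamU.
  have [|] := approximable_prime bA xD'; first by apply: hA => v [].
  by apply: hB => v [/D'AB[]].
have MI : setI_closed M.
  move=> A B [bA hA] [bB _]; split=> [|D' D'AB]; first exact: bfamI.
  by apply: hA => v /D'AB[].
apply: (bfam_sub MU MI) bD.
  move=> A B [bA hA] [bB _]; split=> [|D' D'AB]; first exact: bfamD.
  by apply: hA => v /D'AB[].
apply: (gzero_sub MU MI).
- split=> [|D' D'0 xD']; first exact: gzero_bfam (@gzero0).
  by have [_ [v /D'0]] := filter_es Fxi xD'.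
- move=> v; split=> [|D' D'v xD']; first exact: bfam1.
  exists D' => //; have -> : D' = [set v].
    have [_ [u D'u] _] := filter_es Fxi xD'.
    by apply/seteqP; split=> // _ ->; rewrite -(D'v u D'u).
  by split; [exact: gzero1|left; exists v].
- move=> e; split=> [|D' D'e xD']; first exact: gzero_bfam (gzero_rng e).
  exact: slice_rng_cell D'e xD'.
Qed.

Lemma slice_finite a D : finite_set D -> xi (Some (a, D)) ->
  exists v, xi (Some (a, [set v])).
Proof.
move=> /(@finite_seqP {classic V})[s Ds].
have {Ds} : forall v, D v -> (v : {classic V}) \in s by rewrite Ds.
elim: s D => [|x s IHs] D Ds xD.
  by have [_ [v /Ds]] := filter_es Fxi xD.
have [xI|] := approximable_prime (bfam1 x) xD; last first.
  apply: IHs => v [Dv nxv]; have := Ds v Dv; rewrite inE => /orP[/eqP vx|//].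
  by case: nxv.
exists x; suff <- : D `&` [set x] = [set x] by [].
have [_ [u [Du ux]] _] := filter_es Fxi xI.
by apply/seteqP; split=> [v []//|_ ->]; split=> //; rewrite -(ux : u = x).
Qed.

(** If no singleton occurs at [a] then no finite set does; so a cell which
    occurs is infinite, and a set occurs exactly when it contains all but
    finitely many vertices of that cell. *)
Lemma slice_filt a : occurs xi a -> exists C,
  [/\ cell C, C `<=` path_rng a &
   forall D, es (Some (a, D)) -> xi (Some (a, D)) <-> filt C D].
Proof.
move=> [D0 /slice_cell[K cK xK]].
have [la _ [_ Ka]] := filter_es Fxi xK.
have [[v xv]|nv] := EM (exists v, xi (Some (a, [set v]))).
  have [_ _ [_ va]] := filter_es Fxi xv.
  exists [set v]; split=> //; first by split; [exact: gzero1|left; exists v].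
  move=> D aD; rewrite filt1; split=> [xD|Dv].
    by have [_ [u [-> ]]] := filter_es Fxi (filterI Fxi xv xD).
  by apply: (filter_up Fxi xv aD); left; split=> // _ ->.
have nfin D : xi (Some (a, D)) -> ~ finite_set D.
  by move=> xD fD; apply/nv/(slice_finite fD xD).
exists K; split=> // D aD; have [_ _ [bD _]] := aD; split=> [xD|[KD _]].
  have [//|[+ _]] := filt_dichotomy cK bD.
  by rewrite setDE setCK => /(nfin _ (filterI Fxi xK xD)).
have [xI|/nfin//] := approximable_prime bD xK.
by apply: (filter_up Fxi xI aD); left; split=> // v [].
Qed.

Lemma approximable_Phi_inv : exists2 y, boundary G y & xi = Phi_inv y.
Proof.
have [w [pw xw]] := filter_word Fxi.
have [y [yb yw yend]] : exists y, [/\ boundary G y, point_word y = w &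
    forall a D, w = FinWord a -> es (Some (a, D)) ->
      xi (Some (a, D)) <-> Phi_inv y (Some (a, D))].
  case: w => [a|x] in pw xw *; last first.
    by exists (InfPoint x); split=> //; apply/boundaryE.
  have oa : occurs xi a by apply/xw; exact: begins_refl.
  have na e : ~ occurs xi (rcons a e) by move=> /xw/begins_irrefl.
  have [C [cC Ca xC]] := slice_filt oa; exists (FinPoint a C); split=> //.
    apply/boundaryE; split=> //; split=> //; split=> // v Cv; subst C.
    apply: (approximable_not_regular na); apply/xC; first exact: (es_cell pw).
    exact: filt_self (cell_neq0 cC).
  by move=> b D [<-] aD; rewrite Phi_inv_end//; exact: xC.
exists y => //; apply/seteqP; split=> -[[b B]|].
- move=> xB; have bB := filter_es Fxi xB.
  have bw : begins b w by apply/xw; exists B.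
  have [wb|[e be]] := begins_split bw; first exact: (yend _ _ wb bB).1 xB.
  apply/(@Phi_inv_edge y b e) => //; first by rewrite yw.
  exact: (filter_edge Fxi ((xw _).2 be) bB).1 xB.
- by case: Fxi => _ _ _ _.
- move=> yB; have bB := yB.1; have := Phi_inv_begins yB; rewrite yw => bw.
  have [wb|[e be]] := begins_split bw; first exact: (yend _ _ wb bB).2 yB.
  apply: (filter_edge Fxi ((xw _).2 be) bB).2.
  by apply/(@Phi_inv_edge y b e) => //; rewrite yw.
- by case.
Qed.

End Approximable.

(** * Basic open sets and membership in filters *)

Lemma begins_path_rng (b : seq E) y e : boundary G y ->
  begins (rcons b e) (point_word y) -> path_rng b (src e).
Proof.
by move=> /boundaryE[py _] /(begins_lstar py)/lstar_rcons[].
Qed.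

(** Since [B] is in the generating family, the inclusion [C `<=` B] in the
    definition of the cylinder says that the ultrafilter of [C] contains [B];
    so cylinders are the sets of points whose filter contains an element. *)
Lemma cylE b B y : gzero B ->
  cyl b B y <-> boundary G y /\
  ((exists2 e, B (src e) & begins (rcons b e) (point_word y)) \/
   (exists2 C, filt C B & y = FinPoint b C)).
Proof.
move=> gB; rewrite /cyl /=; split=> -[yb h]; split=> //.
  case: h => [[e Be /extends_byE be]|[C CB yE]]; first by left; exists e.
  right; exists C => //; subst y; have [_ [_ [cC _]]] := (boundaryE _).1 yb.
  exact/filt_cell.
case: h => [[e Be be]|[C CB yE]].
  by left; exists e => //; exact/extends_byE.
right; exists C => //; subst y; have [_ [_ [cC _]]] := (boundaryE _).1 yb.
exact/filt_cell.
Qed.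

Lemma cyl_Phi_inv b B y : ultrapath b B -> boundary G y ->
  cyl b B y <-> Phi_inv y (Some (b, B)).
Proof.
move=> [lb gB Bb] yb; rewrite cylE//; split=> [[_ h]|[_ h]]; split=> //.
split=> //; last by split=> //; exact: gzero_bfam.
case: h => [[e Be _]|[C [_ [v []]]]]; last by exists v.
by exists (src e).
Qed.

Lemma cyl_begins eta y : @lstar G eta -> boundary G y -> (0 < size eta)%N ->
  begins eta (point_word y) <-> cyl eta (path_rng eta) y.
Proof.
move=> leta yb eta0; have geta : gzero (path_rng eta).
  by case: eta leta eta0 => // e eta _ _; exact: gzero_rng.
have eeta : es (Some (eta, path_rng eta)).
  split=> //; last by split=> //; exact: gzero_bfam.
  by case: eta {leta geta} eta0 => // e eta _; exact: rng_neq0.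
have ueta : ultrapath eta (path_rng eta) by split.
rewrite (cyl_Phi_inv ueta yb); split=> [bw|/Phi_inv_begins//].
split=> //; have [yw|[e be]] := begins_split bw; last first.
  by left; exists e => //; exact: begins_path_rng be.
right; case: y => // a C in yb bw yw *; case: yw => aE; subst a.
have [_ [Ca [cC _]]] := (boundaryE _).1 yb; exists C => //.
exact/filt_cell.
Qed.

Lemma base_begins eta y : @lstar G eta -> (0 < size eta)%N ->
  begins eta (point_word y) -> boundary G y ->
  boundary_base (cyl eta (path_rng eta)) /\ cyl eta (path_rng eta) y.
Proof.
move=> leta eta0 bw yb; split; last exact/cyl_begins.
left; exists eta, (path_rng eta); split=> //; split=> //.
by case: eta leta eta0 {bw} => // e eta _ _; exact: gzero_rng.
Qed.

Lemma cyl_finE b B F S y : boundary G y ->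
  cyl_fin b B F S y <->
  [\/ y = FinPoint b B,
      exists e, [/\ B (src e), ~ F e & begins (rcons b e) (point_word y)] |
      exists v, [/\ B v, ~ S v, @sink G v & y = FinPoint b [set v]]].
Proof.
move=> yb; rewrite /cyl_fin /=; split.
- case=> [[->|[_ [e [Be Fe] /extends_byE be]]]|[ysin [v [Bv Sv] yE]]].
  + by constructor 1.
  + by constructor 2; exists e.
  + constructor 3; exists v; split=> //; subst y.
    case: ysin => _ [[u su vu]|[_ infv]]; last by case: (infv (finite_set1 v)).
    by have -> : v = u by have : [set u] v by rewrite -vu.
- case=> [->|[e [Be Fe be]]|[v [Bv Sv sv yE]]].
  + by left; left.
  + by left; right; split=> //; exists e => //; exact/extends_byE.
  + right; split; last by exists v.
    subst y; have [la [va _]] := (boundaryE _).1 yb.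
    by split; [split=> //; exact: gzero1|left; exists v].
Qed.

(** The neighborhood depends on how [b] compares with the word of [y]. If the
    word continues after [b], all points with the same next edge agree with
    [y]. If [y] ends at [b] with a cell [C], the finitely many edges and sinks
    of [C] that decide [A] incorrectly are removed from the basic set of
    [FinPoint b C]. If [b] is not a beginning of the word of [y], either a
    beginning of this word is incompatible with [b], or [y] ends strictly
    before [b] does, and removing the next edge of [b] excludes all points
    that continue along [b]. *)
Lemma Phi_inv_locally_constant b A y : es (Some (b, A)) -> boundary G y ->
  exists N, [/\ @boundary_base G N, N y & forall z, boundary G z -> N z ->
    Phi_inv z (Some (b, A)) <-> Phi_inv y (Some (b, A))].
Proof.
move=> bA yb; have [py yC] := (boundaryE y).1 yb; have [lb _ [bfA Ab]] := bA.
have [by_|nby] := EM (begins b (point_word y)).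
  have [yw|[e be]] := begins_split by_; last first.
    have be0 : (0 < size (rcons b e))%N by rewrite size_rcons.
    have lbe := begins_lstar py be.
    have [Nb Ny] := base_begins lbe be0 be yb.
    exists (cyl (rcons b e) (path_rng (rcons b e))); split=> // z zb.
    by move=> /(cyl_begins lbe zb be0) bez; rewrite !(@Phi_inv_edge _ b e).
  case: y => // a C in yb py yC by_ yw *; case: yw => aE; subst a.
  have [Cb tC] := yC; have [cC _] := tC.
  have [fS fF] := filt_exceptions cC bfA.
  pose F := [set e | @emit G C e /\ ~ (A (src e) <-> filt C A)].
  pose S := [set v | C v /\ ~ (A v <-> filt C A)] `&` [set v | @sink G v].
  exists (cyl_fin b C F S); split.
  - right; exists b, C, F, S; split=> //; first exact/xfinE.
    + by split=> // e [].
    + by split; [exact: finite_setIl|move=> v [[]]].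
  - by left; left.
  - move=> z zb /(cyl_finE _ _ _ _ zb)[->//|[e [Ce nFe be]]|[v [Cv nSv sv ->]]].
      rewrite (Phi_inv_edge be bA) Phi_inv_end//.
      by apply: contrapT => ne; apply: nFe.
    by rewrite !Phi_inv_end// filt1; apply: contrapT => nv; apply: nSv.
have ny : ~ Phi_inv y (Some (b, A)) by move=> /Phi_inv_begins.
suff [N [bN Ny NP]] : exists N, [/\ @boundary_base G N, N y &
    forall z, boundary G z -> N z -> ~ begins b (point_word z)].
  exists N; split=> // z zb Nz; split=> // /Phi_inv_begins bz.
  by case: (NP z zb Nz).
have incomparable (eta : seq E) : begins eta (point_word y) ->
    ~ begins eta (FinWord b) -> (size eta <= size b)%N ->
    exists N, [/\ @boundary_base G N, N y &
      forall z, boundary G z -> N z -> ~ begins b (point_word z)].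
  move=> ey neb le_eb; have leta := begins_lstar py ey.
  have eta0 : (0 < size eta)%N.
    rewrite lt0n; apply/negP => /eqP/size0nil e0; apply: neb.
    by rewrite e0; exact: begins_nil.
  have [Nb Ny] := base_begins leta eta0 ey yb.
  exists (cyl eta (path_rng eta)); split=> // z zb.
  by move=> /(cyl_begins leta zb eta0) ez bz; exact/neb/(begins_total ez bz).
(* [eta] is the beginning of the word of [y] of length [size b], or the whole
   word if it is shorter. *)
have [eta ey seta] : exists2 eta, begins eta (point_word y) &
    (size eta = size b \/ point_word y = FinWord eta /\ (size eta <= size b)%N).
  case: y {yb py yC nby ny incomparable} => [x|a C].
    exists (mkseq x (size b)); first exact: begins_mkseq.
    by left; rewrite size_mkseq.
  have [le_ab|lt_ba] := leqP (size a) (size b).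
    by exists a; [exact: begins_refl|right].
  exists (take (size b) a).
    by exists (drop (size b) a); rewrite cat_take_drop.
  by left; rewrite size_takel// ltnW.
have [eb|neb] := EM (begins eta (FinWord b)); last first.
  by apply: (incomparable eta) => //; case: seta => [->|[]].
case: eb => -[|e c] bE.
  by case: nby; rewrite bE cats0.
case: seta => [|[yE _]].
  move=> sE; have := leqnn (size b).
  by rewrite {1}bE size_cat /= addnS -sE ltnNge leq_addr.
case: y => // d C in yb py yC nby ny ey yE incomparable *.
case: yE => dE; subst d.
have [Cb tC] := yC.
pose F := [set f | @emit G C f /\ f = e].
exists (cyl_fin eta C F set0); split.
- right; exists eta, C, F, set0; split=> //; first exact/xfinE.
    by split; [apply: sub_finite_set (finite_set1 e) => f []|move=> f []].
- by left; left.
- have ebe : begins (rcons eta e) (FinWord b) by exists c; rewrite cat_rcons.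
  move=> z zb /(cyl_finE _ _ _ _ zb)[->//|[f [Cf nFf ef]] bz|[v [Cv _ sv ->]]].
    by apply: nFf; split=> //; exact: begins_next ef (begins_trans ebe bz).
  by move=> /(begins_trans ebe)/begins_irrefl.
Qed.

(** For D_(b,B),F,S the deciding elements are [(b, B)], the elements [(rcons b
    e, rng e)] for [e] in [F], and the elements [(b, [set v])] for [v] in [S].
    A vertex with [B = [set v]] has to be left out, because the point
    [FinPoint b B] belongs to the basic set even if [v] is in [S]. *)
Lemma base_finitely_determined N y :
  @boundary_base G N -> boundary G y -> N y ->
  exists2 S : set ele, finite_set S & forall z, boundary G z ->
    (forall p, S p -> Phi_inv z p <-> Phi_inv y p) -> N z.
Proof.
move=> NN yb; case: NN => [[b [B [b0 uB ->]]] Ny|].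
  exists [set Some (b, B)]; first exact: finite_set1.
  move=> z zb /(_ _ erefl) zy; apply/cyl_Phi_inv => //; apply/zy.
  exact/cyl_Phi_inv.
case=> b [B [F [S [xB [fF FB] [fS SB] ->]]]] /(cyl_finE _ _ _ _ yb) Ny.
have [lb Bb tB] := (xfinE _ _).1 xB; have [cB _] := tB.
have bB := es_cell lb Bb cB.
pose T := [set Some (b, B)] `|` ((fun e => Some (rcons b e, @rng G e)) @` F) `|`
  ((fun v => Some (b, [set v])) @` (S `\` [set v | B = [set v]])).
exists T.
  rewrite !finite_setU; split.
    by split; [exact: finite_set1|exact: finite_image].
  by apply: finite_image; exact: finite_setD.
move=> z zb agree; apply/cyl_finE => //.
have yB : Phi_inv y (Some (b, B)).
  case: Ny => [->|[e [Be _ be]]|[v [Bv _ _ ->]]].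
  - by apply/Phi_inv_end => //; exact: filt_self (cell_neq0 cB).
  - exact/(Phi_inv_edge be).
  - by apply/Phi_inv_end => //; exact/filt1.
have zB : Phi_inv z (Some (b, B)) by apply/agree => //; left; left.
have [zw|[e be]] := begins_split (Phi_inv_begins zB); last first.
  have Be := (Phi_inv_edge be bB).1 zB.
  constructor 2; exists e; split=> // Fe.
  have lbe := begins_lstar ((boundaryE z).1 zb).1 be.
  have er := es_rng lbe.
  have /agree[ag _] : T (Some (rcons b e, rng e)) by left; right; exists e.
  have /ag/Phi_inv_begins bey : Phi_inv z (Some (rcons b e, rng e)).
    rewrite -cyl_Phi_inv//; last first.
      by case: er => _ _ [_ rr]; split=> //; exact: gzero_rng.
    rewrite -[X in cyl _ X](path_rng_rcons b e); apply/cyl_begins => //.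
    by rewrite size_rcons.
  case: Ny => [yE|[f [_ nFf bf]]|[v [_ _ _ yE]]].
  - by move: bey; rewrite yE => /begins_irrefl.
  - by apply: nFf; rewrite (begins_next bf bey).
  - by move: bey; rewrite yE => /begins_irrefl.
case: z => // d C in zb agree zB zw *; case: zw => dE; subst d.
have [_ [Cb tC]] := (boundaryE _).1 zb.
have CB := (filt_cell tC.1 cB.1).1 ((Phi_inv_end _ bB).1 zB).
have [->|[v Cv sv]] := terminal_sub tC tB CB; first by constructor 1.
subst C; have [Bv|nBv] := EM (B = [set v]); first by constructor 1; rewrite Bv.
constructor 3; exists v; split=> //; first exact: CB.
move=> Sv; have bv := es_cell lb Cb tC.1.
have /agree[ag _] : T (Some (b, [set v])) by right; exists v.
have yv : Phi_inv y (Some (b, [set v])).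
  by apply/ag/Phi_inv_end => //; exact/filt1.
case: Ny => [yE|[e [_ _ be]]|[u [_ nSu _ yE]]].
- move: yv; rewrite yE => /(Phi_inv_end _ bv)/(filt_cell cB (gzero1 v)) Bv.
  apply: nBv; apply/seteqP; split=> // _ ->; exact: CB.
- have ev := (Phi_inv_edge be bv).1 yv; suff : @emit G [set v] e by rewrite sv.
  exact: ev.
- move: yv; rewrite yE => /(Phi_inv_end _ bv)/filt1 vu.
  by apply: nSu; rewrite (vu : u = v).
Qed.

(** * The topology of the space of filters *)

Definition agree (xi : filter_space G) (S : set ele) : set (filter_space G) :=
  [set eta | forall p, S p -> filter_elts eta p <-> filter_elts xi p].

Lemma filter_eltsP (xi : filter_space G) : is_filter (filter_elts xi).
Proof. exact: set_valP. Qed.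

Lemma nbhs_agree1 (xi : filter_space G) p : nbhs xi (agree xi [set p]).
Proof.
have [ep|nep] := EM (es p); last first.
  apply: filterS (@filterT _ (nbhs xi) _) => eta _ _ ->.
  by split=> /(filter_es (filter_eltsP _)).
pose i : @es G := SigSub (mem_set ep).
have cont : nbhs (es_char xi) [set f | f i = es_char xi i].
  exact: (@nbhs_coord _ _ (es_char xi) i [set es_char xi i]).
have nb : nbhs xi (@es_char G @^-1` [set f | f i = es_char xi i]).
  exact: (@initial_continuous _ _ (@es_char G) xi _ cont).
apply: filterS nb => eta /= h q ->; exact: asbool_eq_equiv h.
Qed.

(** In a product of discrete spaces a basic neighborhood fixes finitely many
    coordinates. *)
Lemma nbhs_filter_spaceP (xi : filter_space G) U :
  nbhs xi U <-> exists2 S, finite_set S & agree xi S `<=` U.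
Proof.
split=> [|[S fS SU]]; last first.
  apply: filterS SU _.
  have := filter_finite_bigI (nbhs_filter xi) fS (fun p _ => nbhs_agree1 xi p).
  by apply: filterS => eta h p Sp; exact: (h p Sp).
pose F := filter_from (@finite_set ele) (agree xi).
have FF : Filter F.
  apply: filter_from_filter; first by exists set0.
  move=> S T fS fT; exists (S `|` T); first by rewrite finite_setU.
  by move=> eta h; split=> p Sp; apply: h; [left|right].
suff cvF : (@es_char G) @ F --> es_char xi.
  case=> _ [[W oW <-] /= Wxi WU].
  have [S fS SW] : F (@es_char G @^-1` W) by apply: cvF; exact: open_nbhs_nbhs.
  by exists S => // eta /SW; exact: WU.
apply/cvg_sup => i W [_ [[Z oZ <-] /= Zxi ZW]].
exists [set set_val i]; first exact: finite_set1.
move=> eta /(_ _ erefl) h; apply: ZW => /=; move: Zxi.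
by have -> : es_char eta i = es_char xi i := asbool_equiv_eq h.
Qed.

Lemma tight_approximable (xi : filter_space G) :
  tight G xi <-> approximable (filter_elts xi).
Proof.
split=> [txi S fS|axi U /nbhs_filter_spaceP[S fS SU]].
  have /txi[eta [ueta etaS]] : nbhs xi (agree xi S).
    by apply/nbhs_filter_spaceP; exists S.
  by exists (filter_elts eta).
have [eta ueta etaS] := axi S fS.
pose z : @es_filters G := SigSub (mem_set (ueta.1 : @es_filters G eta)).
exists (z : filter_space G); split; first exact: ueta.
exact: SU.
Qed.

Lemma filter_elts_inj : injective (@filter_elts G).
Proof. by move=> xi eta h; apply: val_inj. Qed.

Lemma nbhs_boundary_base (y : boundary_space G) N :
  boundary_base N -> N (set_val (y : boundary G)) ->
  nbhs y [set z : boundary_space G | N (set_val (z : boundary G))].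
Proof.
move=> bN Ny; set U := [set z | _]; rewrite (@nbhsE (boundary_space G)).
exists U => //; split=> //.
exists [set U]; last by rewrite bigcup_set1.
move=> _ ->; exists [fset N]%fset.
  by move=> M /fset1P ->; exact: mem_set.
by rewrite set_fset1 bigcap_set1.
Qed.

(** Continuity may be tested on the generating family, since an open set is a
    union of finite intersections of its members. *)
Lemma continuous_boundary_space (X : topologicalType)
    (f : X -> boundary_space G) :
  (forall x N, boundary_base N -> N (set_val (f x : boundary G)) ->
     nbhs x [set x' | N (set_val (f x' : boundary G))]) ->
  continuous f.
Proof.
move=> hf x U /=; rewrite (@nbhsE (boundary_space G)).
move=> [_ [[B sB <-] [C BC Cfx]] sUBA].
apply: (@filterS _ _ _ (f @^-1` C)).
  by move=> z Cz; apply: sUBA; exists C.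
have [D sD IDeC] := sB _ BC; rewrite -IDeC preimage_bigcap.
apply: filter_bigI => N DN; apply: hf.
  exact: set_mem (sD _ DN).
by move: Cfx; rewrite -IDeC => /(_ _ DN).
Qed.

End Ultragraph.

(** * The homeomorphism *)

Theorem theorem3p18 (G : ultragraph) (hG : RFUM2 G) :
  exists h : tight G -> boundary_space G,
    (forall xi : tight G,
       set_val (h xi : boundary G) = Phi (filter_elts (set_val xi))) /\
    homeomorphism h.
Proof.
have repr (xi : tight G) :
    exists2 y, boundary G y & filter_elts (set_val xi) = Phi_inv y.
  apply: approximable_Phi_inv => //; first exact: filter_eltsP.
  exact/tight_approximable/set_valP.
have Phib (xi : tight G) : boundary G (Phi (filter_elts (set_val xi))).
  by have [y yb ->] := repr xi; rewrite Phi_invK.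
pose h (xi : tight G) : boundary_space G := SigSub (mem_set (Phib xi)).
have tight_repr (y : boundary_space G) : exists xi : tight G,
    filter_elts (set_val xi) = Phi_inv (set_val (y : boundary G)).
  have yb : boundary G (set_val (y : boundary G)) := set_valP _.
  pose z : filter_space G :=
    SigSub (mem_set (Phi_inv_filter yb : @es_filters G _)).
  have tz : tight G z by apply/tight_approximable; exact: Phi_inv_approximable.
  by exists (SigSub (mem_set tz)).
have [g gP] := choice tight_repr.
have hP xi : set_val (h xi : boundary G) = Phi (filter_elts (set_val xi)) by [].
have reprh (xi : tight G) :
    filter_elts (set_val xi) = Phi_inv (set_val (h xi : boundary G)).
  by rewrite hP; have [y yb ->] := repr xi; rewrite Phi_invK.
exists h; split=> //; exists g; split.
- by move=> xi; apply/val_inj/filter_elts_inj; rewrite /= -set_valE gP -reprh.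
- move=> y; apply: val_inj; rewrite -!set_valE hP gP Phi_invK//.
  exact: set_valP.
- apply: continuous_boundary_space => xi N bN Nx.
  have hb := set_valP (h xi : boundary G).
  have [S fS SN] := base_finitely_determined bN hb Nx.
  have nb : nbhs xi (set_val @^-1` agree (set_val xi) S).
    apply: (@initial_continuous _ _ set_val xi).
    by apply/nbhs_filter_spaceP; exists S.
  apply: filterS nb => eta /= ag.
  by apply: SN => [|p Sp]; [exact: set_valP|rewrite -!reprh; exact: ag].
- apply: continuous_comp_initial => y U /= /nbhs_filter_spaceP[S fS SU].
  suff nb : nbhs y (\bigcap_(p in S) [set z | filter_elts (set_val (g z)) p <->
      filter_elts (set_val (g y)) p]).
    by apply: filterS nb => z zS; apply: SU => p; exact: zS.
  apply: filter_finite_bigI => // p Sp.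
  have [ep|nep] := EM (es p); last first.
    apply: filterS (@filterT _ (nbhs y) _) => z _.
    by split=> /(filter_es (filter_eltsP _)).
  case: p ep {Sp} => [[b A]|] ep; last first.
    apply: filterS (@filterT _ (nbhs y) _) => z _ /=.
    by rewrite !gP; split=> -[].
  have yb := set_valP (y : boundary G).
  have [N [bN Ny Nz]] := Phi_inv_locally_constant ep yb.
  apply: filterS (nbhs_boundary_base bN Ny) => z /= /Nz.
  by rewrite !gP; apply; exact: set_valP.
Qed.
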